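(* There is an algorithm which, given $A\in\{0,\ast\}^{d\times d}$ with $d\ge 2$ and a set $F\subset\mathcal{A}$ with $\mu(A,I_F)\le 2$, computes an optimal solution of the problem $$\min_{J\subset F}\ |J|\quad\text{subject to}\quad \mu(A,I_J)\le 2$$ with running time $O(d^3\log d)$.
   Context: Notation: $[d]=\{1,\dots,d\}$. A sparsity matrix is a matrix with entries in $\{0,\ast\}$, where $0$ is a fixed zero and each $\ast$ is an independent free real parameter. For a sparsity matrix $H$, $[H]$ is the set of all real matrices of the same size obtained by giving numerical values to the $\ast$ entries (entries $0$ stay zero). The state vertices associated with $A\in\{0,\ast\}^{d\times d}$ are $\mathcal{A}=\{x_1,\dots,x_d\}$. For $J\subset\mathcal{A}$, $I_J\in\{0,\ast\}^{|J|\times d}$ is obtained from the $d\times d$ sparsity matrix $I_d$ (with $\ast$ on the diagonal and $0$ elsewhere) by retaining the rows corresponding to the state vertices in $J$. For real matrices $\bar A\in\mathbb{R}^{d\times d}$, $\bar C\in\mathbb{R}^{p\times d}$, let $O_k(\bar A,\bar C)=\begin{pmatrix}\bar C^\top & (\bar C\bar A)^\top & \cdots & (\bar C\bar A^{k-1})^\top\end{pmatrix}^\top$. The structural observability index of a pair of sparsity matrices $(A,C)$ is $$\mu(A,C)=\inf\Big\{k\in[d]\ \Big|\ \sup_{A_1\in[A],\,C_1\in[C]}\operatorname{rank} O_k(A_1,C_1)=d\Big\},\qquad \inf\emptyset=+\infty .$$ *)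

(* Defs.v *)
From HB Require Import structures.
From mathcomp Require Import all_boot all_order all_algebra.
From mathcomp Require Import all_classical all_reals all_analysis.

Set Implicit Arguments.
Unset Strict Implicit.
Unset Printing Implicit Defensive.

Import Order.TTheory GRing.Theory Num.Theory.
Local Open Scope classical_set_scope.
Local Open Scope ring_scope.

(** * Structural observability *)

(* [true] is a free parameter, [false] a fixed zero. *)
Definition sparsity (m n : nat) := 'M[bool]_(m, n).

(* Free parameters may take any real value, zero included. *)
Definition realizations (R : realType) m n (H : sparsity m n) :
    set 'M[R]_(m, n) :=
  [set M | forall i j, ~~ H i j -> M i j = 0].

Definition obs_mx (R : realType) d p (k : nat)
    (A : 'M[R]_d) (C : 'M[R]_(p, d)) : 'M[R]_(\sum_(i < k) p, d) :=
  \mxcol_(i < k) (C *m A ^+ i).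

Definition obs_index (R : realType) d p
    (A : sparsity d d) (C : sparsity p d) : \bar R :=
  ereal_inf [set k%:R%:E | k in [set k : nat | (1 <= k <= d)%N /\
    ereal_sup [set (\rank (obs_mx k A1 C1))%:R%:E
                 | A1 in @realizations R _ _ A & C1 in @realizations R _ _ C]
      = d%:R%:E :> \bar R]].

Definition sparsity_id d : sparsity d d := \matrix_(i, j) (i == j).

(* The state vertices are the elements of ['I_d]; the rows are listed in
   increasing order of the vertices of [J]. *)
Definition sparsity_rows d (J : {set 'I_d}) : sparsity #|J| d :=
  rowsub (fun i : 'I_#|J| => enum_val i) (sparsity_id d).

Definition feasible (R : realType) d (A : sparsity d d) (F J : {set 'I_d}) :=
  J \subset F /\ (obs_index R A (sparsity_rows J) <= 2%:E)%E.

Definition optimal (R : realType) d (A : sparsity d d) (F J : {set 'I_d}) :=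
  feasible R A F J /\
  forall J' : {set 'I_d}, feasible R A F J' -> (#|J| <= #|J'|)%N.

(** * Model of computation

   Programs run on a unit-expr_cost random access machine, with scalar variables and
   two-dimensional arrays of natural numbers. Apart from comparisons, with
   values 0 and 1, the successor is the only operation whose value can exceed
   its arguments. Hence after [t] steps every value, array indices included, is
   at most [t] plus the largest of 1, the input values and the constants of the
   program: within polynomial time all values fit in O(log d) bits, so that
   charging one unit per operation is legitimate. *)

Inductive binop := Sub | Eq | Lt.

Inductive expr :=
| Const of nat
| Var of nat
| Cell of nat & expr & expr     (* array name, row index, column index *)
| Succ of expr
| Bin of binop & expr & expr.

Inductive cmd :=
| Skip
| Assign of nat & expr
| Store of nat & expr & expr & expr   (* array name, row, column, value *)
| Seq of cmd & cmd
| If of expr & cmd & cmd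
| While of expr & cmd.

Record state := State {
  vars : nat -> nat;
  arrs : nat -> nat -> nat -> nat
}.

Definition eval_binop (o : binop) (m n : nat) : nat :=
  match o with
  | Sub => (m - n)%N
  | Eq => (m == n)
  | Lt => (m < n)%N
  end.

Fixpoint eval_expr (s : state) (e : expr) : nat :=
  match e with
  | Const n => n
  | Var x => vars s x
  | Cell a i j => arrs s a (eval_expr s i) (eval_expr s j)
  | Succ e => (eval_expr s e).+1
  | Bin o e1 e2 => eval_binop o (eval_expr s e1) (eval_expr s e2)
  end.

(* The number of elementary operations performed by [eval_expr]. *)
Fixpoint expr_cost (e : expr) : nat :=
  match e with
  | Const _ | Var _ => 1%N
  | Cell _ i j => (expr_cost i + expr_cost j).+1%N
  | Succ e => (expr_cost e).+1
  | Bin _ e1 e2 => (expr_cost e1 + expr_cost e2).+1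
  end.

Definition set_var (s : state) (x v : nat) : state :=
  State (fun y => if y == x then v else vars s y) (arrs s).

Definition set_cell (s : state) (a i j v : nat) : state :=
  State (vars s) (fun a' i' j' =>
    if [&& a' == a, i' == i & j' == j] then v else arrs s a' i' j').

(* [exec c s t s'] : started in [s], the program [c] halts in [s'] after [t]
   steps. A test succeeds when its value is nonzero. *)
Inductive exec : cmd -> state -> nat -> state -> Prop :=
| ExecSkip s : exec Skip s 1 s
| ExecAssign x e s :
    exec (Assign x e) s (expr_cost e).+1 (set_var s x (eval_expr s e))
| ExecStore a i j e s :
    exec (Store a i j e) s (expr_cost i + expr_cost j + expr_cost e).+1
      (set_cell s a (eval_expr s i) (eval_expr s j) (eval_expr s e))
| ExecSeq c1 c2 s1 s2 s3 t1 t2 :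
    exec c1 s1 t1 s2 -> exec c2 s2 t2 s3 ->
    exec (Seq c1 c2) s1 (t1 + t2)%N s3
| ExecIfTrue e c1 c2 s s' t :
    eval_expr s e != 0%N -> exec c1 s t s' ->
    exec (If e c1 c2) s (expr_cost e + t).+1 s'
| ExecIfFalse e c1 c2 s s' t :
    eval_expr s e = 0%N -> exec c2 s t s' ->
    exec (If e c1 c2) s (expr_cost e + t).+1 s'
| ExecWhileTrue e c s1 s2 s3 t1 t2 :
    eval_expr s1 e != 0%N -> exec c s1 t1 s2 -> exec (While e c) s2 t2 s3 ->
    exec (While e c) s1 (expr_cost e + t1 + t2).+1 s3
| ExecWhileFalse e c s :
    eval_expr s e = 0%N -> exec (While e c) s (expr_cost e).+1 s.

(* Variable 0 holds [d], array 0 the 0/1 entries of [A], row 0 of array 1 the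
   indicator of [F]; everything else is 0. *)
Definition input_state d (A : sparsity d d) (F : {set 'I_d}) : state :=
  State
    (fun x => if x is 0 then d else 0%N)
    (fun a i j =>
       match a, insub i, insub j with
       | 0%N, Some u, Some v => nat_of_bool (A u v)
       | 1%N, _, Some v => nat_of_bool ((i == 0%N) && (v \in F))
       | _, _, _ => 0%N
       end).

(* The answer is read off from row 0 of array 2, as an indicator. *)
Definition output_set d (s : state) : {set 'I_d} :=
  [set i : 'I_d | arrs s 2 0 i != 0%N]%SET.

(* Main.v *)
From HB Require Import structures.
From mathcomp Require Import all_boot all_order all_fingroup all_algebra.
From mathcomp Require Import all_classical all_reals all_analysis.
From mathcomp Require Import zify.
From Stdlib Require Import FunctionalExtensionality.
Require Import Defs.

Set Implicit Arguments.
Unset Strict Implicit.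
Unset Printing Implicit Defensive.

(** With two observation steps, the rows of the observability matrix of
    [(A, I_J)] are multiples of the unit rows of [J] and of the rows of [A] with
    index in [J]. By the Leibniz formula its generic rank is [d] if and only if
    every state outside [J] can be assigned a state of [J] of its own whose row
    of [A] is free at it ([obs_index_le2]). The pairs of such an assignment are
    disjoint: they form a matching in the undirected graph whose edges join [u]
    in [F] to [v] when [A u v] is free. Conversely, orienting the edges of a
    matching that covers the complement of [F] and removing the heads leaves a
    feasible set. Hence the least size is [d] minus the size of a maximum
    matching ([assigned_matching], [maximum_matching_optimal]).

    A maximum matching that covers the complement of [F] is found in two runs
    of Edmonds' algorithm. In the first one only the edges between [F] and its
    complement are used; as [F] itself is feasible, a maximum matching of this
    bipartite graph covers the complement of [F] ([cut_maximum_covers]). The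
    second run starts from this matching and uses the whole graph; augmenting
    never uncovers a vertex.

    A phase of the algorithm grows an alternating forest from all exposed
    vertices at once and ends with an augmenting path or with a proof of
    maximality: the classes of outer vertices with a common base are odd and
    joined only to inner vertices, which bounds all matchings
    ([barrier_maximum]). Every outer vertex stores a whole even alternating path
    from a root. Two facts about the stored paths suffice to keep them simple
    through blossom contractions: the path of the base of any vertex on a path
    is an initial segment of it, and these segments grow along the path
    ([forest], [forest_grow], [forest_contract]). Then the common bases of two
    paths form a chain, and beyond the last one the paths are disjoint.

    A vertex becomes outer at most once in a phase, at the cost of writing a
    path of length at most [d], and a contraction makes some vertex outer, which
    pays for its passes over all vertices. So a phase takes time [O(d ^ 2)]
    ([phaseP]), the [2 d] phases take [O(d ^ 3)] ([programP]), and [ln d] is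
    bounded below by [ln 2]. *)

(** * Matchings as involutions *)

(** The vertices are the numbers below [d]; unmatched vertices are the fixed
    points. *)
Definition matching (d : nat) (e : rel nat) (m : nat -> nat) :=
  forall v, v < d -> [/\ m v < d, m (m v) = v & m v != v -> e v (m v)].

Definition exposed (d : nat) (m : nat -> nat) :=
  [seq v <- iota 0 d | m v == v].

Definition maximum_matching d e m :=
  matching d e m /\
  forall m', matching d e m' -> size (exposed d m) <= size (exposed d m').

Lemma mem_vertices d v : (v \in iota 0 d) = (v < d).
Proof. by rewrite mem_iota. Qed.

Lemma mem_exposed d m v : (v \in exposed d m) = (m v == v) && (v < d).
Proof. by rewrite mem_filter mem_vertices. Qed.

(** An involution without fixed points pairs off the elements of the list. *)
Lemma fixfree_involution_even (f : nat -> nat) (s : seq nat) :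
  uniq s -> (forall v, v \in s -> [/\ f v \in s, f (f v) = v & f v != v]) ->
  ~~ odd (size s).
Proof.
have [n] := ubnP (size s); elim: n s => // n IHn [|x s] //= lt_s /andP[xs us] fs.
have [fxs ffx nfx] := fs x (mem_head x s).
have fx_s: f x \in s by move: fxs; rewrite inE (negPf nfx).
have s_gt0 : 0 < size s by case: (s) fx_s.
have: ~~ odd (size (rem (f x) s)).
  apply: IHn; first by rewrite size_rem // (leq_ltn_trans (leq_pred _)).
    exact: rem_uniq.
  move=> v; rewrite mem_rem_uniq // inE => /andP[/= vfx vs].
  have [fv ffv nfv] := fs v (mem_behead (s := x :: s) vs).
  split=> //; rewrite mem_rem_uniq // inE /=; apply/andP; split.
    by apply: contra xs => /eqP/(congr1 f); rewrite ffv ffx => <-.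
  by move: fv; rewrite inE => /predU1P[fvx|//]; case/eqP: vfx; rewrite -fvx ffv.
by rewrite size_rem //; case: (size s) s_gt0 => //= k _; rewrite negbK.
Qed.

(** Weak duality for the Tutte-Berge formula: removing the inner vertices
    isolates the odd sets formed by the outer vertices with a common
    representative, and every matching leaves exposed or matches to an inner
    vertex some vertex of each odd set. *)
Lemma barrier_maximum d e m (seen outer : pred nat) (rep : nat -> nat) :
  matching d e m ->
  (forall v, v < d -> m v = v -> outer v /\ rep v = v) ->
  (forall v, outer v -> seen v) ->
  (forall v, v < d -> seen v ->
     [/\ rep v < d, outer (rep v), rep (rep v) = rep v,
         seen (m v) & rep (m v) = rep v]) ->
  (forall v, v < d -> seen v -> ~~ outer v -> rep v = m v) ->
  (forall v, v < d -> outer v -> rep v = v -> m v != v -> ~~ outer (m v)) ->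
  (forall u v, u < d -> v < d -> outer u -> e u v ->
     seen v /\ (outer v -> rep u = rep v)) ->
  maximum_matching d e m.
Proof.
move=> mm fixO outer_seen repP innerP baseP closed; split=> // m' mm'.
pose inner := [seq v <- iota 0 d | seen v && ~~ outer v].
pose bases := [seq v <- iota 0 d | outer v && (rep v == v)].
have le1: size (inner ++ exposed d m) <= size bases.
  rewrite -(size_map m bases); apply: uniq_leq_size.
    rewrite cat_uniq !filter_uniq ?iota_uniq //= andbT.
    apply/hasPn=> v; rewrite mem_exposed => /andP[/eqP mv vd].
    by have [ov _] := fixO v vd mv; rewrite mem_filter ov andbF.
  move=> v; rewrite mem_cat mem_exposed mem_filter mem_vertices.
  case/orP=> [/andP[/andP[sv nov] vd] | /andP[/eqP mv vd]]; last first.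
    have [ov rv] := fixO v vd mv.
    by rewrite -mv map_f // mem_filter ov rv eqxx mem_vertices.
  have [mvd mmv _] := mm v vd; have [rd orv rrv _ _] := repP v vd sv.
  rewrite -mmv map_f // mem_filter mem_vertices mvd.
  by rewrite -(innerP v vd sv nov) orv rrv eqxx.
pose owner v := if outer v then rep v else rep (m' v).
pose outer_exposed := [seq v <- exposed d m' | outer v].
have le2: size bases <= size (inner ++ outer_exposed).
  rewrite -(size_map owner (_ ++ _)); apply: uniq_leq_size.
    by rewrite filter_uniq ?iota_uniq.
  move=> b; rewrite mem_filter mem_vertices => /andP[/andP[ob /eqP rb] bd].
  (* The odd set of the base b. *)
  pose C := [seq v <- iota 0 d | outer v && (rep v == b)].
  have memC v : (v \in C) = [&& v < d, outer v & rep v == b].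
    by rewrite mem_filter mem_vertices andbC.
  have uC : uniq C by rewrite filter_uniq ?iota_uniq.
  have bC : b \in C by rewrite memC bd ob rb eqxx.
  have oddC : ~~ odd (size (rem b C)).
    apply: (fixfree_involution_even (f := m)); first exact: rem_uniq.
    move=> v; rewrite mem_rem_uniq // inE memC => /= /andP[vb /and3P[vd ov /eqP rv]].
    have [mvd mmv _] := mm v vd.
    have [_ _ _ smv rmv] := repP v vd (outer_seen v ov).
    have omv : outer (m v).
      apply: contraT => nomv; have := innerP _ mvd smv nomv.
      by rewrite rmv mmv rv => bv; rewrite bv eqxx in vb.
    have mvv : m v != v.
      by apply: contra vb => /eqP mv; have [_ <-] := fixO v vd mv; apply/eqP.
    split=> //; rewrite mem_rem_uniq // inE memC /= mvd omv rmv rv eqxx !andbT.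
    apply: contraTneq (ov) => mvb; rewrite -mmv mvb; apply: baseP => //.
    by rewrite -mvb mmv eq_sym.
  have{oddC} oddC : odd (size C).
    move: oddC; rewrite size_rem //; case: (C) bC => //= c l _.
  have /hasP[v] : has (fun v => (m' v == v) || (m' v \in inner)) C.
    apply: contraLR oddC => /hasPn noC.
    apply: (fixfree_involution_even (f := m')) => // v vC.
    have:= noC v vC; rewrite negb_or => /andP[m'v ni].
    move: vC; rewrite memC => /and3P[vd ov /eqP rv].
    have [m'd m'm' ev] := mm' v vd.
    have [sm' rm'] := closed v (m' v) vd m'd ov (ev m'v).
    have om' : outer (m' v).
      by move: ni; rewrite mem_filter mem_vertices m'd sm' andbT /= negbK.
    by split=> //; rewrite memC m'd om' -rm' // rv eqxx.
  rewrite memC => /and3P[vd ov /eqP rv] /orP[/eqP m'v|im'].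
    have <- : owner v = b by rewrite /owner ov.
    by rewrite map_f // mem_cat !mem_filter ov m'v eqxx mem_vertices vd orbT.
  have <- : owner (m' v) = b.
    rewrite /owner; move: im'; rewrite mem_filter => /andP[/andP[_ /negPf->] _].
    by have [_ -> _] := mm' v vd.
  by rewrite map_f // mem_cat im'.
have := leq_trans le1 le2; rewrite !size_cat leq_add2l => /leq_trans; apply.
by rewrite size_filter count_size.
Qed.

(** * Alternating paths *)

Definition upd (U : Type) (f : nat -> U) (x : nat) (v : U) : nat -> U :=
  fun y => if y == x then v else f y.

(** [p] continues a path at [x] by pairs of an edge and a matched edge. *)
Fixpoint alternating (e : rel nat) (m : nat -> nat) (x : nat) (p : seq nat) :=
  match p with
  | [::] => true
  | [:: y] => false
  | [:: y, z & q] => [&& e x y, m y == z & alternating e m z q]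
  end.

(** Alternating paths are consumed by pairs of vertices. *)
Lemma pair_ind (Q : seq nat -> Prop) :
  Q [::] -> (forall y, Q [:: y]) -> (forall y z q, Q q -> Q [:: y, z & q]) ->
  forall q, Q q.
Proof.
move=> Q0 Q1 Q2 q; have [n] := ubnP (size q).
elim: n q => // n IHn [|y [|z q]] //= lt_q.
by apply: Q2; apply: IHn; rewrite -ltnS ltnW.
Qed.

Lemma alternating_cat e m x p q :
  alternating e m x p ->
  alternating e m x (p ++ q) = alternating e m (last x p) q.
Proof.
elim/pair_ind: p x => [|y|y z p IHp] x //=.
by move=> /and3P[-> -> /IHp ->].
Qed.

Lemma alternating_split e m x p :
  alternating e m x p -> p != [::] ->
  exists q y z,
    [/\ p = q ++ [:: y; z], alternating e m x q, e (last x q) y & m y = z].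
Proof.
elim/pair_ind: p x => [|y|y z p IHp] x //= /and3P[exy /eqP myz zp] _.
have [-> | p_neq0] := eqVneq p [::]; first by exists [::], y, z.
have [q [y' [z' [-> zq qy' my'z']]]] := IHp z zp p_neq0.
by exists [:: y, z & q], y', z'; split; rewrite //= exy myz eqxx zq.
Qed.

Lemma alternating_rev e m x p v :
  symmetric e -> (forall y, y \in p -> m (m y) = y) ->
  alternating e m x p -> p != [::] -> e v (last x p) ->
  alternating e m v (rev p).
Proof.
move=> e_sym; elim/pair_ind: p x v => [|y|y z p IHp] x v //= mm.
move=> /and3P[exy /eqP myz zp] _ ev.
have mzy : m z = y by rewrite -myz mm ?mem_head.
rewrite !rev_cons -!cats1 -catA /=.
have [p0 | p_neq0] := eqVneq p [::]; first (move: ev; rewrite p0 /= => ->; rewrite ?mzy ?eqxx //).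
have mm' y' : y' \in p -> m (m y') = y' by move=> y'p; rewrite mm // !inE y'p !orbT.
rewrite alternating_cat; last exact: (IHp z).
case: p zp p_neq0 {IHp mm mm' ev} => [|y' [|z' p]] //= /and3P[ezy' _ _] _.
by rewrite rev_cons last_rcons e_sym ezy' mzy eqxx.
Qed.

Lemma eq_alternating e m m' x p :
  {in p, m =1 m'} -> alternating e m x p = alternating e m' x p.
Proof.
elim/pair_ind: p x => [|y|y z p IHp] x //= mm'.
rewrite mm' ?mem_head // IHp // => w wp.
by rewrite mm' // !inE wp !orbT.
Qed.

(** Shifting the matched edges of an alternating path one step towards its
    start exposes its last vertex instead of its first one. *)
Fixpoint flip (m : nat -> nat) (x : nat) (p : seq nat) :=
  if p is [:: y, z & q] then flip (upd (upd (upd m x y) y x) z z) z q else m.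

Lemma flipP d e m x p :
  symmetric e -> matching d e m ->
  m x = x -> alternating e m x p -> uniq (x :: p) -> all (fun y => y < d) (x :: p) ->
  [/\ matching d e (flip m x p),
      forall v, v \notin x :: p -> flip m x p v = m v
    & forall v, (flip m x p v == v) = (v == last x p) || (v != x) && (m v == v)].
Proof.
move=> e_sym; elim/pair_ind: p x m => [|y|y z p IHp] x m mm mx //.
  move=> _ _ _; split=> // v /=.
  by have [-> | vx] := eqVneq v x; rewrite //= mx eqxx.
move=> /and3P[exy /eqP myz zp].
rewrite [uniq _]/= !inE !negb_or => /and4P[/and3P[xy xz xp] /andP[yz yp] zNp up].
rewrite [all _ _]/= => /and4P[xd yd zd pd] /=.
have mzy : m z = y by rewrite -myz; have [] := mm y yd.
set m' := upd (upd (upd m x y) y x) z z.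
have m'E v : m' v = if v == z then z else if v == y then x else
                    if v == x then y else m v by [].
have mm' : matching d e m'.
  move=> v vd; rewrite !m'E; have [mvd mmv ev] := mm v vd.
  have [-> | vz] := eqVneq v z; first by rewrite eqxx.
  have [-> | vy] := eqVneq v y.
    by rewrite (negPf xz) (negPf xy) eqxx e_sym exy.
  have [-> | vx] := eqVneq v x.
    by rewrite (negPf yz) eqxx exy.
  have mvz : m v != z by apply: contra vy => /eqP mvz; rewrite -mmv mvz mzy.
  have mvy : m v != y by apply: contra vz => /eqP mvy; rewrite -mmv mvy myz.
  have mvx : m v != x by apply: contra vx => /eqP mvx; rewrite -mmv mvx mx.
  by rewrite (negPf mvz) (negPf mvy) (negPf mvx).
have outside v : v \notin [:: x; y; z] -> m' v = m v.
  by rewrite !inE !negb_or m'E => /and3P[/negPf-> /negPf-> /negPf->].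
have p_out v : v \in p -> v \notin [:: x; y; z].
  by move=> vp; rewrite !inE; apply/negP=> /or3P[] /eqP vE; rewrite -vE vp in xp yp zNp.
have [] := IHp z m' mm'.
- by rewrite m'E eqxx.
- by rewrite (@eq_alternating e m' m) // => v vp; rewrite outside ?p_out.
- by rewrite /= zNp.
- by rewrite /= zd.
move=> mf ff fix_f; split=> // v.
  rewrite !inE !negb_or => /and4P[vx vy vz vp].
  by rewrite ff ?outside // !inE !negb_or ?vx ?vy ?vz.
rewrite fix_f m'E; case: (v == last z p) => //=.
have [-> | vz] /= := eqVneq v z; first by rewrite mzy (negPf yz) andbF.
have [-> | vy] := eqVneq v y; first by rewrite (negPf xy) myz (eq_sym z) (negPf yz) andbF.
by have [-> | vx] /= := eqVneq v x; rewrite // eq_sym (negPf xy).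
Qed.

(** A last vertex reached by a matched edge is matched. *)
Lemma alternating_fix d e m x p :
  matching d e m -> alternating e m x p ->
  uniq (x :: p) -> all (fun y => y < d) (x :: p) ->
  m (last x p) = last x p -> p = [::].
Proof.
move=> mm xp up pd; have [//|p_neq0] := eqVneq p [::].
have [q [y [z [pE _ _ myz]]]] := alternating_split xp p_neq0.
have yd : y < d by apply: (allP pd); rewrite pE !(inE, mem_cat) eqxx !orbT.
have [_ mmy _] := mm y yd.
rewrite pE last_cat /= -myz mmy => yz.
by move: up; rewrite pE -myz -yz /= cat_uniq /= inE eqxx !andbF.
Qed.

Section Augment.

Variables (d : nat) (e : rel nat) (m : nat -> nat).
Hypotheses (e_sym : symmetric e) (mm : matching d e m).

(** Even alternating paths start at an exposed vertex and end with a matched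
    edge. *)
Definition even_path (v : nat) (p : seq nat) :=
  exists x q, [/\ p = x :: q, m x = x, alternating e m x q, last x q = v &
                  uniq p && all (fun y => y < d) p].

Definition flip_path (m : nat -> nat) p := if p is x :: q then flip m x q else m.

Definition augment u v p q :=
  upd (upd (flip_path (flip_path m p) q) u v) v u.

(** After both paths are flipped their ends are exposed, and the edge between
    them can be matched; the two roots become covered. *)
Lemma augmentP u v p q :
  even_path u p -> even_path v q -> ~~ has (mem p) q -> e u v ->
  [/\ matching d e (augment u v p q),
      forall w, w < d -> m w != w -> augment u v p q w != w
    & size (exposed d (augment u v p q)) < size (exposed d m)].
Proof.
move=> [x [p' [pE mx xp' lp /andP[up pd]]]] [y [q' [qE my yq' lq /andP[uq qd]]]].
move=> /hasPn disj euv.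
rewrite pE in up pd; rewrite qE in uq qd.
have [mm1 out1 fix1] := flipP e_sym mm mx xp' up pd; rewrite -pE in out1.
have y_out : y \notin p by apply: disj; rewrite qE mem_head.
have q_out w : w \in q -> flip m x p' w = m w by move=> /disj /out1.
have my1 : flip m x p' y = y by rewrite q_out // qE mem_head.
have yq1 : alternating e (flip m x p') y q'.
  rewrite (@eq_alternating _ _ m) // => w wq; apply: q_out.
  by rewrite qE inE wq orbT.
have [mm2 _ fix2] := flipP e_sym mm1 my1 yq1 uq qd.
rewrite /augment pE qE /=; set m2 := flip _ y q' in mm2 fix2 *.
have vq : v \in q by rewrite qE -lq mem_last.
have uv : u != v by apply: contraNneq (disj v vq) => <- /=; rewrite pE -lp mem_last.
have ud : u < d by apply: (allP pd); rewrite -lp mem_last.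
have vd : v < d by apply: (allP qd); rewrite -lq mem_last.
have m2u : m2 u = u.
  apply/eqP; rewrite fix2 fix1 lp eqxx andbT /= orbC.
  suff -> : u != y by [].
  by apply: contraTneq y_out => <-; rewrite negbK pE -lp mem_last.
have m2v : m2 v = v by apply/eqP; rewrite fix2 lq eqxx.
have fix3 w : (upd (upd m2 u v) v u w == w) = [&& w != x, w != y & m w == w].
  rewrite /upd; have [-> | wv] := eqVneq w v.
    rewrite (negPf uv); apply/esym/negP => /and3P[_ vy /eqP mv].
    by case/negP: vy; rewrite -lq (alternating_fix mm yq') ?lq.
  have [-> | wu] := eqVneq w u.
    rewrite eq_sym (negPf uv); apply/esym/negP => /and3P[ux _ /eqP mu].
    by case/negP: ux; rewrite -lp (alternating_fix mm xp') ?lp.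
  rewrite fix2 fix1 lp lq (negPf wv) (negPf wu) /=.
  by rewrite andbCA.
split.
- move=> w wd; rewrite /upd; have [m2d m2m2 ew] := mm2 w wd.
  have [-> | wv] := eqVneq w v; first by rewrite eqxx (negPf uv) e_sym.
  have [-> | wu] := eqVneq w u; first by rewrite eqxx.
  have m2w_u : m2 w != u by apply: contra wu => /eqP m2w; rewrite -m2m2 m2w m2u.
  have m2w_v : m2 w != v by apply: contra wv => /eqP m2w; rewrite -m2m2 m2w m2v.
  by rewrite (negPf m2w_u) (negPf m2w_v).
- move=> w wd mw; rewrite fix3 (negPf mw) !andbF //.
- rewrite -[_.+1]/(size (x :: _)); apply: uniq_leq_size.
    by rewrite /= filter_uniq ?iota_uniq // mem_exposed fix3 eqxx.
  move=> w; rewrite inE !mem_exposed fix3 => /predU1P[->|].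
    by rewrite mx eqxx (allP pd) ?mem_head.
  by case/andP=> /and3P[_ _ ->].
Qed.
End Augment.

(** * Alternating forests with blossoms *)

Lemma prefix_comparable (a b c : seq nat) :
  prefix a c -> prefix b c -> size a <= size b -> prefix a b.
Proof.
move=> ac; rewrite prefixE => /eqP bc le_ab.
by rewrite prefixE -{1}bc take_takel // -prefixE.
Qed.

Lemma prefix_mem (a b : seq nat) y : prefix a b -> y \in a -> y \in b.
Proof. by move=> /prefixP[c ->] ya; rewrite mem_cat ya. Qed.

Section Forest.

Variables (d : nat) (e : rel nat) (m : nat -> nat).
Hypotheses (e_sym : symmetric e) (mm : matching d e m).

(** An alternating forest in which blossoms have been contracted: [seen] are the
    vertices that it reaches, [outer] those that it reaches by an even path, and
    [P] gives such a path. The representative of an outer vertex is the base of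
    its blossom, and that of an inner vertex is its mate; matched vertices
    then have the same representative. [forest_prefix] and [forest_sorted]
    replace the tree structure: the bases of the blossoms on a path are met in
    the order of their own paths, which are its initial segments. *)
Record forest (seen outer : pred nat) (rep : nat -> nat) (P : nat -> seq nat) :
    Prop := Forest {
  forest_lt : forall v, seen v -> v < d;
  forest_seen : forall v, outer v -> seen v;
  forest_exposed : forall v, v < d -> m v = v -> outer v /\ rep v = v;
  forest_rep : forall v, seen v ->
    [/\ outer (rep v), rep (rep v) = rep v, seen (m v) & rep (m v) = rep v];
  forest_inner : forall v, seen v -> ~~ outer v -> rep v = m v;
  forest_base : forall v, outer v -> rep v = v -> m v != v -> ~~ outer (m v);
  forest_path : forall v, outer v -> even_path d e m v (P v);
  forest_prefix : forall u y, outer u -> y \in P u ->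
    seen y && prefix (P (rep y)) (P u);
  forest_sorted : forall u, outer u ->
    sorted (fun y z => size (P (rep y)) <= size (P (rep z))) (P u)
}.

(** An edge to an unseen vertex makes this vertex inner and its mate outer. *)
Lemma forest_grow seen outer rep P u v :
  forest seen outer rep P -> outer u -> e u v -> v < d -> ~~ seen v ->
  let w := m v in
  forest (fun y => [|| seen y, y == v | y == w])
         (fun y => outer y || (y == w))
         (upd (upd rep v w) w w)
         (upd P w (P u ++ [:: v; w])).
Proof.
move=> [lt_d outS fixO repP innP baseP pathP preP sortP] ou euv vd nsv w.
have [wd mw _] := mm vd; rewrite -/w in wd mw.
have nov : ~~ outer v by apply: contra nsv => /outS.
have wv : w != v.
  by apply: contra nov => /eqP wv; have [] := fixO v vd wv.
have nsw : ~~ seen w by apply: contra nsv => sw; rewrite -mw; have [] := repP w sw.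
have now : ~~ outer w by apply: contra nsw => /outS.
have outw y : outer y -> (y == w) = false.
  by move=> oy; apply: contraNF now => /eqP <-.
have outv y : outer y -> (y == v) = false.
  by move=> oy; apply: contraNF nov => /eqP <-.
have seenw y : seen y -> (y == w) = false.
  by move=> sy; apply: contraNF nsw => /eqP <-.
have seenv y : seen y -> (y == v) = false.
  by move=> sy; apply: contraNF nsv => /eqP <-.
have old y : seen y -> [/\ upd (upd rep v w) w w y = rep y
   & upd P w (P u ++ [:: v; w]) (upd (upd rep v w) w w y) = P (rep y)].
  move=> sy; have [or _ _ _] := repP y sy.
  by rewrite /upd seenw // seenv // outw.
have new y : y = v \/ y = w -> [/\ upd (upd rep v w) w w y = w
   & upd P w (P u ++ [:: v; w]) (upd (upd rep v w) w w y) = P u ++ [:: v; w]].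
  by case=> ->; rewrite /upd ?eqxx // (eq_sym v) (negPf wv) eqxx.
have Pw : upd P w (P u ++ [:: v; w]) w = P u ++ [:: v; w] by rewrite /upd eqxx.
have fresh y : y \in P u -> (y == v = false) * (y == w = false).
  by move=> yu; have /andP[sy _] := preP u y ou yu; rewrite seenv ?seenw.
have pw : even_path d e m w (P u ++ [:: v; w]).
  have [x [q [uE mx xq lq /andP[uq qd]]]] := pathP u ou.
  exists x, (q ++ [:: v; w]); split=> //; first by rewrite uE.
  - by rewrite alternating_cat //= lq euv eqxx.
  - by rewrite last_cat.
  - rewrite cat_uniq all_cat uq qd /= vd wd orbF inE !andbT (eq_sym v) wv andbT.
    by rewrite negb_or; apply/andP; split; apply/negP=> /fresh; rewrite eqxx => -[].
split.
- by move=> y /or3P[/lt_d|/eqP->|/eqP->].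
- by move=> y /orP[/outS->|->]; rewrite ?orbT.
- move=> y yd my; have [oy ry] := fixO y yd my.
  by rewrite oy; have [-> _] := old y (outS y oy).
- move=> y; have [sy _|nsy /= yvw] := boolP (seen y).
    have [or rr sm rm] := repP y sy; have [-> _] := old y sy.
    have [-> _] := old _ sm; have [-> _] := old _ (outS _ or).
    by rewrite or sm.
  have yvw' : y = v \/ y = w by case/orP: yvw => /eqP; [left|right].
  have myvw : m y = v \/ m y = w by case: yvw' => ->; [right|left].
  have [-> _] := new y yvw'; have [-> _] := new _ myvw.
  have [-> _] := new w (or_intror erefl).
  by rewrite eqxx orbT; split=> //; case: myvw => ->; rewrite eqxx !orbT.
- move=> y; have [sy _|nsy /=] := boolP (seen y).
    by rewrite negb_or => /andP[noy _]; have [-> _] := old y sy; apply: innP.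
  case: eqP => [-> _|_] /=; last by move=> ->; rewrite orbT.
  by have [-> _] := new v (or_introl erefl).
- move=> y /orP[oy|/eqP->].
    have [-> _] := old y (outS y oy) => ry my.
    rewrite negb_or baseP //=; apply: contraNneq nov => myw.
    by have [_ mmy _] := mm (lt_d _ (outS _ oy)); rewrite -mw -myw mmy.
  by rewrite mw (negPf nov) eq_sym.
- move=> y /orP[oy|/eqP->]; last by rewrite /upd eqxx.
  by rewrite /upd outw //; apply: pathP.
- move=> u' y ou'.
  have [ou'o | u'w] : outer u' \/ u' = w by case/orP: ou' => [|/eqP]; auto.
    have -> : upd P w (P u ++ [:: v; w]) u' = P u' by rewrite /upd outw.
    move=> yu'; have /andP[sy pre] := preP u' y ou'o yu'.
    by rewrite sy; have [_ ->] := old y sy.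
  rewrite u'w Pw mem_cat => /orP[yu | yvw].
    have /andP[sy pre] := preP u y ou yu; rewrite sy; have [_ ->] := old y sy.
    by rewrite (prefix_trans pre) // prefix_prefix.
  have yvw' : y = v \/ y = w by move: yvw; rewrite !inE => /orP[]/eqP; auto.
  have [_ ->] := new y yvw'; rewrite prefix_refl andbT.
  by move: yvw; rewrite !inE => /orP[->|->]; rewrite !orbT.
- move=> u' ou'.
  have sortu u1 : outer u1 -> sorted (fun y z =>
     size (upd P w (P u ++ [:: v; w]) (upd (upd rep v w) w w y)) <=
     size (upd P w (P u ++ [:: v; w]) (upd (upd rep v w) w w z))) (P u1).
    move=> ou1; apply: sub_in_sorted (sortP u1 ou1); last first.
      by apply/allP=> y /(preP u1 y ou1) /andP[sy _]; exact: sy.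
    by move=> y z sy sz; have [_ ->] := old y sy; have [_ ->] := old z sz.
  have [ou'o | u'w] : outer u' \/ u' = w by case/orP: ou' => [|/eqP]; auto.
    have -> : upd P w (P u ++ [:: v; w]) u' = P u' by rewrite /upd outw.
    exact: sortu.
  rewrite u'w Pw.
  have tr : transitive (fun y z =>
     size (upd P w (P u ++ [:: v; w]) (upd (upd rep v w) w w y)) <=
     size (upd P w (P u ++ [:: v; w]) (upd (upd rep v w) w w z))).
    by move=> a b c; apply: leq_trans.
  rewrite sorted_pairwise // pairwise_cat -!sorted_pairwise // sortu //= andbT.
  have [_ ->] := new v (or_introl erefl); have [_ ->] := new w (or_intror erefl).
  rewrite leqnn andbT; apply/allrelP => y z yu; rewrite !inE => zvw.
  have [_ ->] : [/\ upd (upd rep v w) w w z = w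
   & upd P w (P u ++ [:: v; w]) (upd (upd rep v w) w w z) = P u ++ [:: v; w]].
    by apply: new; case/orP: zvw => /eqP; auto.
  have /andP[sy pre] := preP u y ou yu; have [_ ->] := old y sy.
  by apply: leq_trans (size_prefix pre) _; rewrite size_cat leq_addr.
Qed.

Lemma forest_init (seen : pred nat) (rep : nat -> nat) (P : nat -> seq nat) :
  (forall v, seen v = (v < d) && (m v == v)) ->
  (forall v, seen v -> rep v = v /\ P v = [:: v]) ->
  forest seen seen rep P.
Proof.
move=> seenE start.
have seenP v : seen v -> [/\ v < d, m v = v, rep v = v & P v = [:: v]].
  move=> sv; have [rv Pv] := start v sv.
  by move: (sv); rewrite seenE => /andP[? /eqP].
split=> //.
- by move=> v /seenP[].
- by move=> v vd mv; rewrite seenE vd mv eqxx; have [] := start v; rewrite // seenE vd mv eqxx.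
- by move=> v sv; have [_ -> -> _] := seenP v sv; have [_ _ ->] := seenP v sv; rewrite sv.
- by move=> v ->.
- by move=> v sv _; have [_ ->] := seenP v sv; rewrite eqxx.
- move=> v sv; have [vd mv _ ->] := seenP v sv.
  by exists v, [::]; rewrite /= vd mv.
- move=> u y su; have [_ _ ru Pu] := seenP u su.
  by rewrite Pu inE => /eqP ->; rewrite su ru Pu prefix_refl.
- by move=> u su; have [_ _ _ ->] := seenP u su.
Qed.

Section ForestTheory.

Variables (seen outer : pred nat) (rep : nat -> nat) (P : nat -> seq nat).
Hypothesis (F : forest seen outer rep P).

Lemma even_path_last v p : even_path d e m v p -> exists q, p = rcons q v.
Proof.
move=> [x [q [-> _ _ <- _]]]; case/lastP: q => [|q z]; first by exists [::].
by exists (x :: q); rewrite last_rcons -rcons_cons.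
Qed.

Lemma mem_path v : outer v -> v \in P v.
Proof.
move=> /(forest_path F)/even_path_last[q ->].
by rewrite mem_rcons mem_head.
Qed.

Lemma path_uniq v : outer v -> uniq (P v).
Proof. by move=> /(forest_path F)[x [q [_ _ _ _ /andP[]]]]. Qed.

Lemma path_nth v : outer v -> nth 0 (P v) (size (P v)).-1 = v.
Proof.
move=> /(forest_path F)/even_path_last[q ->].
by rewrite size_rcons nth_rcons ltnn eqxx.
Qed.

Lemma path_size v : outer v -> 0 < size (P v) <= d.
Proof.
move=> /(forest_path F)[x [q [-> _ _ _ /andP[uq /allP qd]]]] /=.
rewrite -[_.+1]/(size (x :: q)) -[d in _ <= d](size_iota 0); apply: uniq_leq_size => //.
by move=> y /qd; rewrite mem_vertices.
Qed.

(** The bases on a path are those whose own path is an initial segment, so a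
    single comparison of vertices decides this. *)
Lemma base_on_pathP u r : outer u -> outer r -> rep r = r ->
  prefix (P r) (P u) =
    (size (P r) <= size (P u)) && (nth 0 (P u) (size (P r)).-1 == r).
Proof.
move=> ou or rr; apply/idP/andP => [pre|[le_ru /eqP nth_r]].
  rewrite size_prefix //; split=> //; move/prefixP: pre (path_nth or) => [s ->].
  have /andP[r_gt0 _] := path_size or.
  by rewrite nth_cat prednK // leqnn => ->.
have ru : r \in P u.
  rewrite -nth_r mem_nth //; have /andP[r_gt0 _] := path_size or.
  by rewrite prednK.
by have /andP[_] := forest_prefix F ou ru; rewrite rr.
Qed.

Lemma bases_eq r r' u : outer r -> outer r' ->
  prefix (P r) (P u) -> prefix (P r') (P u) -> size (P r) = size (P r') -> r = r'.
Proof.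
move=> or or'; rewrite !prefixE => /eqP pr /eqP pr' sz.
by rewrite -(path_nth or) -(path_nth or') -pr -pr' sz.
Qed.

Lemma rep_prefix u y : outer u -> y \in P u -> prefix (P (rep y)) (P u).
Proof. by move=> ou yu; case/andP: (forest_prefix F ou yu). Qed.

Lemma rep_base v : seen v -> outer (rep v) /\ rep (rep v) = rep v.
Proof. by move=> /(forest_rep F)[]. Qed.

Lemma rep_outer_prefix u : outer u -> prefix (P (rep u)) (P u).
Proof. by move=> ou; apply: rep_prefix (mem_path ou). Qed.

Lemma sorted_before u a b y z : outer u -> P u = a ++ b -> y \in a -> z \in b ->
  size (P (rep y)) <= size (P (rep z)).
Proof.
move=> ou uE ya zb; have := forest_sorted F ou.
rewrite sorted_pairwise; last by move=> ? ? ?; apply: leq_trans.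
by rewrite uE pairwise_cat => /and3P[/allrelP/(_ y z ya zb)].
Qed.

Lemma le_rep u y : outer u -> y \in P u -> size (P (rep y)) <= size (P (rep u)).
Proof.
move=> ou; have [q qE] := even_path_last (forest_path F ou).
rewrite qE mem_rcons inE => /predU1P[-> //|yq].
by apply: (sorted_before ou (a := q) (b := [:: u])); rewrite ?cats1 ?inE.
Qed.

Lemma root_base u : outer u ->
  let x := nth 0 (P u) 0 in
  [/\ outer x, rep x = x, prefix (P x) (P u) & m x = x].
Proof.
move=> ou; have [x [q [uE mx _ _ /andP[_ qd]]]] := forest_path F ou; rewrite uE /=.
have xd : x < d by apply: (allP qd); rewrite uE mem_head.
have [ox rx] := forest_exposed F xd mx.
have xu : x \in P u by rewrite uE mem_head.
by split=> //; have := rep_prefix ou xu; rewrite rx uE.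
Qed.

Lemma common_base_root u v r : outer r ->
  prefix (P r) (P u) -> prefix (P r) (P v) -> nth 0 (P u) 0 = nth 0 (P v) 0.
Proof.
move=> or /prefixP[s ->] /prefixP[s' ->].
by case/andP: (path_size or) => r_gt0 _; rewrite !nth_cat r_gt0.
Qed.

(** The representative of a common vertex is a common base, whose path would
    start at both roots. *)
Lemma distinct_roots_disjoint u v : outer u -> outer v ->
  nth 0 (P u) 0 != nth 0 (P v) 0 -> ~~ has (mem (P u)) (P v).
Proof.
move=> ou ov; apply: contra => /hasP[y yv /= yu]; apply/eqP.
have /andP[sy _] := forest_prefix F ou yu; have [or _] := rep_base sy.
by apply: (common_base_root or); apply: rep_prefix.
Qed.

(** The part of the path of [u] from the mate of the base [r] onwards; the
    mate is the last vertex but one of the path of [r]. *)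
Definition tail_from r u := drop (size (P r) - 2) (P u).

Lemma tail_fromP u r : outer u -> outer r -> rep r = r ->
  prefix (P r) (P u) -> 1 < size (P r) ->
  [/\ P u = take (size (P r) - 2) (P u) ++ tail_from r u,
      exists t, tail_from r u = [:: m r, r & t],
      exists x, alternating e m x (tail_from r u) &
      forall y, y \in tail_from r u -> size (P r) <= size (P (rep y))].
Proof.
move=> ou or rr pre r_gt1.
have uE : P u = take (size (P r) - 2) (P u) ++ tail_from r u by rewrite cat_take_drop.
have [x [q [rE mx xq lq /andP[_ qd]]]] := forest_path F or.
have q_neq0 : q != [::] by move: r_gt1; rewrite rE; case: (q).
have [q0 [y [z [qE xq0 q0y myz]]]] := alternating_split xq q_neq0.
have zr : z = r by rewrite -lq qE last_cat.
have yd : y < d by apply: (allP qd); rewrite rE qE !(inE, mem_cat) eqxx !orbT.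
have mr : m r = y by rewrite -zr -myz; have [] := mm yd.
have [s usE] := prefixP pre.
have sz2 : size (P r) - 2 = size (x :: q0).
  by rewrite rE qE /= size_cat /= addn2 subn2.
have tE : tail_from r u = [:: m r, r & s].
  rewrite /tail_from sz2 usE rE qE -cat_cons -catA drop_size_cat // mr zr //.
have [xu [qu [uE' _ xqu _ _]]] := forest_path F ou.
split=> //; first by exists s.
- have quE : qu = q0 ++ tail_from r u.
    by have := uE'; rewrite usE rE qE tE mr -zr /= -catA => -[_ <-].
  have xxu : xu = x by have := uE'; rewrite usE rE => -[].
  by exists (last x q0); rewrite -(alternating_cat _ xq0) -quE -xxu.
- move=> w; rewrite tE -[[:: m r, r & s]]cat1s mem_cat orbC => /orP[wb|].
    have [_ _ _ rm] := forest_rep F (forest_seen F or).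
    rewrite -{1}rr -rm; apply: (sorted_before ou (a := rcons (x :: q0) (m r)) _ _ wb).
      by rewrite usE rE qE mr zr /= cat_rcons -catA.
    by rewrite mem_rcons mem_head.
  rewrite inE => /eqP->; have [_ _ _ ->] := forest_rep F (forest_seen F or).
  by rewrite rr.
Qed.

(** An inner vertex of one path is reached evenly by going up the other path
    and coming back. *)
Lemma turn_even_path x u v r :
  outer u -> outer v -> e u v ->
  (forall y, outer y -> rep y = y -> prefix (P y) (P u) -> prefix (P y) (P v) ->
     size (P y) <= size (P x)) ->
  outer r -> rep r = r -> prefix (P r) (P u) -> 0 < size (P x) < size (P r) ->
  even_path d e m (m r) (P v ++ rev (tail_from r u)).
Proof.
move=> ou ov euv xmax or rr pre /andP[x_gt0 lt_xr].
have r_gt1 : 1 < size (P r) by apply: leq_ltn_trans lt_xr.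
have [uE [t tE] [y yt] ge_r] := tail_fromP ou or rr pre r_gt1.
have [xv [qv [vE mxv xqv lqv /andP[uv vd]]]] := forest_path F ov.
have tail_lt w : w \in tail_from r u -> w < d.
  move=> wt; apply: (forest_lt F).
  by have /andP[] := forest_prefix F ou (mem_drop wt).
exists xv, (qv ++ rev (tail_from r u)); split=> //; first by rewrite vE.
- rewrite alternating_cat // lqv; apply: (alternating_rev (x := y)) => //.
  + by move=> w /tail_lt/mm[].
  + by rewrite tE.
  rewrite e_sym; have [q uqE] := even_path_last (forest_path F ou).
  suff -> : last y (tail_from r u) = u by [].
  have: last 0 (P u) = u by rewrite uqE last_rcons.
  by rewrite uE last_cat tE.
- by rewrite last_cat tE rev_cons last_rcons.
- rewrite cat_uniq uv rev_uniq drop_uniq ?path_uniq // andbT all_cat vd all_rev.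
  apply/andP; split; last by apply/allP => w; exact: tail_lt.
  apply/hasPn=> w; rewrite mem_rev => wt /=; apply: contraL lt_xr => wv.
  have wu := mem_drop wt; have /andP[sw _] := forest_prefix F ou wu.
  have [orw rrw] := rep_base sw; rewrite -leqNgt (leq_trans (ge_r w wt)) //.
  by apply: xmax => //; apply: rep_prefix.
Qed.

End ForestTheory.

(** The edge [u v] joins two outer vertices, and [x] is the last base that their
    paths have in common. *)
Section Contract.

Variables (seen outer : pred nat) (rep : nat -> nat) (P : nat -> seq nat).
Hypothesis (F : forest seen outer rep P).
Variables (u v x : nat).
Hypotheses (ou : outer u) (ov : outer v) (euv : e u v).
Hypotheses (ox : outer x) (rx : rep x = x).
Hypotheses (xu : prefix (P x) (P u)) (xv : prefix (P x) (P v)).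
Hypothesis xmax : forall y, outer y -> rep y = y ->
  prefix (P y) (P u) -> prefix (P y) (P v) -> size (P y) <= size (P x).

(** The bases absorbed by the blossom that the edge [u v] closes above [x]. *)
Definition absorbed r :=
  (size (P x) < size (P r)) && (prefix (P r) (P u) || prefix (P r) (P v)).

Definition contract_outer y := outer y || seen y && absorbed (rep y).

Definition contract_rep y := if seen y && absorbed (rep y) then x else rep y.

Definition contract_path y :=
  if [&& seen y, ~~ outer y & absorbed (rep y)] then
    if prefix (P (rep y)) (P u) then P v ++ rev (tail_from P (rep y) u)
    else P u ++ rev (tail_from P (rep y) v)
  else P y.

Let x_gt0 : 0 < size (P x).
Proof. by have /andP[] := path_size F ox. Qed.

Lemma absorbed_x : absorbed x = false.
Proof. by rewrite /absorbed ltnn. Qed.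

(** The absorbed bases on any path form an interval directly above [x]. *)
Lemma absorbed_above y r w :
  absorbed r -> prefix (P y) (P w) -> prefix (P r) (P w) ->
  size (P y) <= size (P r) -> ~~ absorbed y -> size (P y) <= size (P x).
Proof.
move=> /andP[_ onuv] yw rw le_yr.
have yr := prefix_comparable yw rw le_yr.
rewrite /absorbed negb_and -leqNgt => /orP[//|].
by case/orP: onuv => /(prefix_trans yr) ->; rewrite ?orbT.
Qed.

Lemma absorbed_prefix w r : outer w -> absorbed r -> prefix (P r) (P w) -> prefix (P x) (P w).
Proof.
move=> ow /andP[/ltnW le_xr onuv] rw; apply: prefix_trans rw.
by case/orP: onuv => [ru|rv]; [apply: prefix_comparable xu ru _
                              | apply: prefix_comparable xv rv _].
Qed.

Lemma contract_path_outer y : outer y -> contract_path y = P y.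
Proof. by rewrite /contract_path => ->; rewrite andbF. Qed.

Lemma contract_repP y : seen y ->
  [/\ outer (contract_rep y), rep (contract_rep y) = contract_rep y,
      contract_rep (contract_rep y) = contract_rep y &
      contract_path (contract_rep y) = P (contract_rep y)].
Proof.
move=> sy; have [or rr] := rep_base F sy; have sx := forest_seen F ox.
rewrite /contract_rep sy /=; case: ifP => ab.
  by rewrite sx rx absorbed_x contract_path_outer.
by rewrite (forest_seen F or) rr ab contract_path_outer.
Qed.

Lemma contract_prefix w y : outer w -> y \in P w ->
  prefix (P (contract_rep y)) (P w).
Proof.
move=> ow yw; have /andP[sy pre] := forest_prefix F ow yw.
by rewrite /contract_rep sy /=; case: ifP => // ab; apply: absorbed_prefix ab pre.
Qed.

Lemma contract_sorted w : outer w ->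
  sorted (fun y z => size (P (contract_rep y)) <= size (P (contract_rep z))) (P w).
Proof.
move=> ow; apply: (@sub_in_sorted _ (mem (P w))) (forest_sorted F ow); last exact/allP.
move=> y z /= yw zw le_yz.
have /andP[sy prey] := forest_prefix F ow yw.
have /andP[sz prez] := forest_prefix F ow zw.
rewrite /contract_rep sy sz /=; case: ifP => [/andP[lt_xy _]|aby].
  by case: ifP => // abz; apply: leq_trans le_yz; apply: ltnW.
case: ifP => // abz.
by apply: absorbed_above abz prey prez le_yz _; rewrite ?aby.
Qed.

(** A base on the path of [u] or [v] is absorbed as soon as it lies above [x]. *)
Lemma contract_below w y : outer w -> y \in P w -> w = u \/ w = v ->
  size (P (contract_rep y)) <= size (P x).
Proof.
move=> ow yw w_uv; have /andP[sy pre] := forest_prefix F ow yw.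
rewrite /contract_rep sy /=; case: ifP => // /negbT.
rewrite /absorbed negb_and -leqNgt => /orP[// |].
by case: w_uv pre => -> ->; rewrite ?orbT.
Qed.

(** The base of an end of the edge is the highest one on its path, which passes
    through [x]; so it is absorbed unless it is [x] itself. *)
Lemma contract_end w : outer w -> w = u \/ w = v -> contract_rep w = x.
Proof.
move=> ow w_uv; have sw := forest_seen F ow; have [or rr] := rep_base F sw.
have pre := rep_outer_prefix F ow.
rewrite /contract_rep sw /=; case: ifP => // /negbT.
have onuv : prefix (P (rep w)) (P u) || prefix (P (rep w)) (P v).
  by case: w_uv pre => -> ->; rewrite ?orbT.
rewrite /absorbed onuv andbT -leqNgt => le_rx.
have xw : prefix (P x) (P w) by case: w_uv => ->.
apply: (bases_eq F or ox pre xw); apply/eqP; rewrite eqn_leq le_rx /=.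
have xPw : x \in P w by apply: prefix_mem xw (mem_path F ox).
by rewrite -{1}rx (le_rep F).
Qed.

(** A vertex that turns outer lies on one of the two paths above [x]; its new
    path goes up the other one and comes back. *)
Lemma new_outerP y : seen y -> ~~ outer y -> absorbed (rep y) ->
  exists w w',
    [/\ w = u /\ w' = v \/ w = v /\ w' = u, outer w, outer w' &
     [/\ contract_path y = P w' ++ rev (tail_from P (rep y) w),
        forall z, z \in tail_from P (rep y) w -> z \in P w,
        forall z, z \in tail_from P (rep y) w -> contract_rep z = x,
        y \in tail_from P (rep y) w &
        even_path d e m y (contract_path y)]].
Proof.
move=> sy noy ab.
have [orr rrr] := rep_base F sy; set r := rep y in ab orr rrr *.
have ry : r = m y by apply: forest_inner F _ _ _.
have mr : m r = y by rewrite ry; have [] := mm (forest_lt F sy).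
have [lt_xr onuv] := andP ab.
have r_gt1 : 1 < size (P r) by apply: leq_ltn_trans lt_xr.
have tail_rep w w' z : (w = u /\ w' = v \/ w = v /\ w' = u) -> outer w ->
    prefix (P r) (P w) -> z \in tail_from P r w -> contract_rep z = x.
  move=> ww' ow rw zt; have [_ _ _ ge_r] := tail_fromP F ow orr rrr rw r_gt1.
  have /andP[sz prez] := forest_prefix F ow (mem_drop zt).
  rewrite /contract_rep sz /absorbed (leq_trans lt_xr (ge_r z zt)) /=.
  suff -> : prefix (P (rep z)) (P u) || prefix (P (rep z)) (P v) by [].
  by case: ww' prez => -[-> _] ->; rewrite ?orbT.
have y_tail w : outer w -> prefix (P r) (P w) -> y \in tail_from P r w.
  move=> ow rw; have [_ [t ->] _ _] := tail_fromP F ow orr rrr rw r_gt1.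
  by rewrite mr mem_head.
rewrite /contract_path sy noy ab /= -/r; case: ifP => ru.
  exists u, v; split; auto; split=> //.
  - by move=> z; apply: mem_drop.
  - by move=> z; apply: (tail_rep u v); auto.
  - exact: y_tail.
  - by rewrite -{1}mr; apply: (turn_even_path F ou ov euv xmax); rewrite ?x_gt0.
have rv : prefix (P r) (P v) by rewrite ru in onuv.
exists v, u; split; auto; split=> //.
- by move=> z; apply: mem_drop.
- by move=> z; apply: (tail_rep v u); auto.
- exact: y_tail.
- rewrite -{1}mr; apply: (turn_even_path F ov ou _ _ orr rrr rv).
  + by rewrite e_sym.
  + by move=> w ow rw wv wu; apply: xmax.
  + by rewrite x_gt0.
Qed.

Lemma contract_outer_seen y : contract_outer y -> seen y.
Proof. by move=> /orP[/(forest_seen F)|/andP[]]. Qed.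

Lemma forest_contract : forest seen contract_outer contract_rep contract_path.
Proof.
have path_cases y : contract_outer y -> outer y \/
    [/\ seen y, ~~ outer y & absorbed (rep y)].
  rewrite /contract_outer; have [oy|noy] := boolP (outer y); first by auto.
  by move=> /= /andP[sy ab]; right; rewrite sy ab.
have prefix_cases y w : contract_outer w -> y \in contract_path w ->
   seen y /\ prefix (P (contract_rep y)) (contract_path w).
  move=> /path_cases[ow|[sw now ab]].
    rewrite contract_path_outer // => yw.
    by have /andP[sy _] := forest_prefix F ow yw; rewrite contract_prefix.
  have [a [b [ab_uv oa ob [-> tail_a tail_x wt _]]]] := new_outerP sw now ab.
  have xb : prefix (P x) (P b) by case: ab_uv => -[_ ->].
  rewrite mem_cat mem_rev => /orP[yb|yt].
    have /andP[sy _] := forest_prefix F ob yb; split=> //.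
    by apply: prefix_trans (contract_prefix ob yb) _; apply: prefix_prefix.
  have /andP[sy _] := forest_prefix F oa (tail_a y yt); split=> //.
  by rewrite tail_x //; apply: prefix_trans xb _; apply: prefix_prefix.
split.
- exact: (forest_lt F).
- exact: contract_outer_seen.
- move=> y yd my; have [oy ry] := forest_exposed F yd my.
  rewrite /contract_outer oy /contract_rep ry; split=> //; case: ifP => // /andP[_].
  have [w [q [yE mw wq lq /andP[uq qd]]]] := forest_path F oy.
  have : w :: q = [:: w].
    by rewrite (alternating_fix mm wq) // ?lq // -yE.
  by rewrite -yE /absorbed => ->; rewrite ltnNge x_gt0.
- move=> y sy; have [or rr rrr _] := contract_repP sy.
  rewrite rrr /contract_outer or; split=> //; have [_ _ sm rm] := forest_rep F sy => //.
  by rewrite /contract_rep sm rm sy.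
- move=> y sy; rewrite /contract_outer negb_or sy /= => /andP[noy nab].
  by rewrite /contract_rep sy (negPf nab) /=; apply: forest_inner F _ _ _.
- move=> y /path_cases[oy|[sy noy ab]]; last first.
    by rewrite /contract_rep sy ab => /= xy; rewrite -xy ox in noy.
  have sy := forest_seen F oy.
  have ry : contract_rep y = y -> rep y = y.
    by rewrite /contract_rep; case: ifP => // _ <-.
  move=> ryy my; have {}ry := ry ryy; have [_ _ sm rm] := forest_rep F sy.
  rewrite /contract_outer negb_or (forest_base F oy ry my) sm rm ry /=.
  apply/negP => ab; move: ryy; rewrite /contract_rep sy ry ab /= => xy.
  by rewrite -xy absorbed_x in ab.
- move=> y /path_cases[oy|[sy noy ab]].
    by rewrite contract_path_outer //; apply: forest_path F _ _.
  by have [w [w' [_ _ _ []]]] := new_outerP sy noy ab.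
- move=> w y ow yw; have [sy pre] := prefix_cases y w ow yw.
  by have [_ _ _ ->] := contract_repP sy; rewrite sy.
- move=> w ow.
  apply: (@sub_in_sorted _ (mem (contract_path w))
    (fun y z => size (P (contract_rep y)) <= size (P (contract_rep z)))).
  + move=> y z /= yw zw; have [sy _] := prefix_cases y w ow yw.
    have [sz _] := prefix_cases z w ow zw.
    by have [_ _ _ ->] := contract_repP sy; have [_ _ _ ->] := contract_repP sz.
  + exact/allP.
  case/path_cases: ow => [ow|[sw now ab]].
    by rewrite contract_path_outer //; apply: contract_sorted.
  have [a [b [ab_uv oa ob [-> tail_a tail_x wt _]]]] := new_outerP sw now ab.
  have b_uv : b = u \/ b = v by case: ab_uv => -[_ ->]; auto.
  have tr : transitive
      (fun y z => size (P (contract_rep y)) <= size (P (contract_rep z))).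
    by move=> ? ? ?; apply: leq_trans.
  rewrite sorted_pairwise // pairwise_cat -sorted_pairwise // contract_sorted //=.
  apply/andP; split.
    apply/allrelP => y z yb; rewrite mem_rev => /tail_x ->.
    exact: contract_below yb b_uv.
  apply/(pairwiseP 0) => i j; rewrite !inE => ilt jlt _.
  by rewrite !tail_x // -mem_rev mem_nth.
Qed.

Lemma contract_outer_mono y : outer y -> contract_outer y.
Proof. by rewrite /contract_outer => ->. Qed.

(** The mate of an absorbed base is inner before and outer after; this vertex
    pays for the time of the contraction. *)
Lemma contract_progress : rep u != rep v ->
  exists y, [/\ y < d, ~~ outer y & contract_outer y].
Proof.
move=> ruv.
have [w [ow w_uv nrx]] : exists w, [/\ outer w, w = u \/ w = v & rep w != x].
  have [ru|ru] := eqVneq (rep u) x; last by exists u; split; [|left|].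
  by exists v; split; [|right|rewrite -ru eq_sym].
have sw := forest_seen F ow; have [or rr] := rep_base F sw.
have ab : absorbed (rep w).
  by apply: contraNT nrx => nab; have := contract_end ow w_uv;
    rewrite /contract_rep sw (negPf nab) => /= ->.
have [_ _ sm rm] := forest_rep F (forest_seen F or).
have mw : m (rep w) != rep w.
  apply: contraTneq ab => mw; have [z [q [zE mz zq lq /andP[uq qd]]]] := forest_path F or.
  have : z :: q = [:: z] by rewrite (alternating_fix mm zq) // ?lq // -zE.
  by rewrite -zE /absorbed => ->; rewrite ltnNge x_gt0.
exists (m (rep w)); split.
- by have [] := mm (forest_lt F (forest_seen F or)).
- exact: (forest_base F).
- by rewrite /contract_outer sm rm rr ab orbT.
Qed.

End Contract.

(** A forest that no edge can extend proves that the matching is maximum. *)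
Lemma forest_maximum seen outer rep P :
  forest seen outer rep P ->
  (forall u v, outer u -> v < d -> e u v -> seen v /\ (outer v -> rep u = rep v)) ->
  maximum_matching d e m.
Proof.
move=> F closed; apply: (barrier_maximum (seen := seen) (outer := outer) (rep := rep)) => //.
- exact: (forest_exposed F).
- exact: (forest_seen F).
- move=> v vd sv; have [or rr sm rm] := forest_rep F sv; split=> //.
  exact: (forest_lt F (forest_seen F or)).
- by move=> v _; apply: (forest_inner F).
- by move=> v _; apply: (forest_base F).
- by move=> u v _ vd ou; apply: closed.
Qed.

End Forest.

(** * A program logic with running times *)

(** The program [c] halts when started in [s], and its running time and final
    state satisfy [Q]. *)
Definition wp (c : cmd) (s : state) (Q : nat -> state -> Prop) :=
  exists t s', exec c s t s' /\ Q t s'.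

Fixpoint written_vars (c : cmd) : seq nat :=
  match c with
  | Skip | Store _ _ _ _ => [::]
  | Assign x _ => [:: x]
  | Seq c1 c2 | If _ c1 c2 => written_vars c1 ++ written_vars c2
  | While _ c => written_vars c
  end.

Fixpoint written_arrs (c : cmd) : seq nat :=
  match c with
  | Skip | Assign _ _ => [::]
  | Store a _ _ _ => [:: a]
  | Seq c1 c2 | If _ c1 c2 => written_arrs c1 ++ written_arrs c2
  | While _ c => written_arrs c
  end.

(** The part of the state that [c] cannot modify. It is computed from the text
    of [c], so invariants only speak of what a loop changes. *)
Definition frame (c : cmd) (s s' : state) :=
  (forall x, x \notin written_vars c -> vars s' x = vars s x) /\
  (forall a, a \notin written_arrs c -> arrs s' a = arrs s a).

Lemma exec_frame c s t s' : exec c s t s' -> frame c s s'.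
Proof.
elim=> {c s t s'} [s|x e s|a i j e s|c1 c2 s1 s2 s3 t1 t2 _ [v1 a1] _ [v2 a2]
  |e c1 c2 s s' t _ _ [v1 a1]|e c1 c2 s s' t _ _ [v2 a2]
  |e c s1 s2 s3 t1 t2 _ _ [v1 a1] _ [v2 a2]|e c s _]; split=> //= y.
- by rewrite inE => /negPf->.
- by rewrite inE => /negPf->.
- by rewrite mem_cat negb_or => /andP[y1 y2]; rewrite v2 // v1.
- by rewrite mem_cat negb_or => /andP[y1 y2]; rewrite a2 // a1.
- by rewrite mem_cat negb_or => /andP[y1 y2]; rewrite v1.
- by rewrite mem_cat negb_or => /andP[y1 y2]; rewrite a1.
- by rewrite mem_cat negb_or => /andP[y1 y2]; rewrite v2.
- by rewrite mem_cat negb_or => /andP[y1 y2]; rewrite a2.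
- by move=> yc; rewrite v2 // v1.
- by move=> yc; rewrite a2 // a1.
Qed.

Lemma wp_conseq c s (Q Q' : nat -> state -> Prop) :
  wp c s Q -> (forall t s', frame c s s' -> Q t s' -> Q' t s') -> wp c s Q'.
Proof.
move=> [t [s' [ex q]]] QQ'; exists t, s'; split=> //.
exact: QQ' (exec_frame ex) q.
Qed.

Lemma wp_skip s (Q : nat -> state -> Prop) : Q 1 s -> wp Skip s Q.
Proof. by move=> q; exists 1, s; split=> //; apply: ExecSkip. Qed.

Lemma wp_assign x e s (Q : nat -> state -> Prop) :
  Q (expr_cost e).+1 (set_var s x (eval_expr s e)) -> wp (Assign x e) s Q.
Proof. by move=> q; do 2!eexists; split; [apply: ExecAssign|]. Qed.

Lemma wp_store a i j e s (Q : nat -> state -> Prop) :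
  Q (expr_cost i + expr_cost j + expr_cost e).+1
    (set_cell s a (eval_expr s i) (eval_expr s j) (eval_expr s e)) ->
  wp (Store a i j e) s Q.
Proof. by move=> q; do 2!eexists; split; [apply: ExecStore|]. Qed.

Lemma wp_seq c1 c2 s (Q : nat -> state -> Prop) :
  wp c1 s (fun t1 s1 => wp c2 s1 (fun t2 s2 => Q (t1 + t2) s2)) ->
  wp (Seq c1 c2) s Q.
Proof.
move=> [t1 [s1 [ex1 [t2 [s2 [ex2 q]]]]]].
by exists (t1 + t2), s2; split=> //; apply: ExecSeq ex1 ex2.
Qed.

Lemma wp_if e c1 c2 s (Q : nat -> state -> Prop) :
  (eval_expr s e != 0 -> wp c1 s (fun t s' => Q (expr_cost e + t).+1 s')) ->
  (eval_expr s e = 0 -> wp c2 s (fun t s' => Q (expr_cost e + t).+1 s')) ->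
  wp (If e c1 c2) s Q.
Proof.
case: (eqVneq (eval_expr s e) 0) => [e0 _ /(_ e0)|e_neq0 /(_ isT) + _].
  move=> [t [s' [ex q]]]; exists (expr_cost e + t).+1, s'; split=> //.
  exact: ExecIfFalse.
move=> [t [s' [ex q]]]; exists (expr_cost e + t).+1, s'; split=> //.
exact: ExecIfTrue.
Qed.

Lemma wp_if_bool (b : bool) e c1 c2 s (Q : nat -> state -> Prop) :
  eval_expr s e = b ->
  (b -> wp c1 s (fun t s' => Q (expr_cost e + t).+1 s')) ->
  (~~ b -> wp c2 s (fun t s' => Q (expr_cost e + t).+1 s')) ->
  wp (If e c1 c2) s Q.
Proof.
by move=> eb c1Q c2Q; apply: wp_if; rewrite eb;
  [rewrite eqb0 negbK|move/eqP; rewrite eqb0].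
Qed.

Lemma wp_while_true e c s (Q : nat -> state -> Prop) :
  eval_expr s e != 0 ->
  wp c s (fun t1 s1 =>
    wp (While e c) s1 (fun t2 s2 => Q (expr_cost e + t1 + t2).+1 s2)) ->
  wp (While e c) s Q.
Proof.
move=> e_neq0 [t1 [s1 [ex1 [t2 [s2 [ex2 q]]]]]].
exists (expr_cost e + t1 + t2).+1, s2; split=> //; exact: ExecWhileTrue ex1 ex2.
Qed.

Lemma wp_while_false e c s (Q : nat -> state -> Prop) :
  eval_expr s e = 0 -> Q (expr_cost e).+1 s -> wp (While e c) s Q.
Proof. by move=> e0 q; do 2!eexists; split; [apply: ExecWhileFalse|]. Qed.

Definition For (x : nat) (e : expr) (body : cmd) : cmd :=
  Seq (Assign x (Const 0))
    (While (Bin Lt (Var x) e) (Seq body (Assign x (Succ (Var x))))).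

Lemma frame_trans c s1 s2 s3 : frame c s1 s2 -> frame c s2 s3 -> frame c s1 s3.
Proof.
move=> [v1 a1] [v2 a2]; split=> [x xc|a ac]; first by rewrite v2 // v1.
by rewrite a2 // a1.
Qed.

Lemma frame_set_var c s x v : x \in written_vars c -> frame c s (set_var s x v).
Proof. by move=> xc; split=> //= y; case: eqP => // ->; rewrite xc. Qed.

Lemma frame_for x e c s s' : frame c s s' -> frame (For x e c) s s'.
Proof.
move=> [vs as_]; split=> [y|a].
  by rewrite /= inE mem_cat !negb_or => /and3P[_ /vs].
by rewrite /= cats0 => /as_.
Qed.

(** The invariant [I k t s] describes the state [s] reached after [k]
    iterations whose bodies took [t] steps altogether. *)
Lemma wp_for x e body N (I : nat -> nat -> state -> Prop) s
    (Q : nat -> state -> Prop) :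
  x \notin written_vars body ->
  I 0 0 (set_var s x 0) ->
  (forall k t s1, k <= N -> frame (For x e body) s s1 -> vars s1 x = k ->
     I k t s1 -> eval_expr s1 e = N) ->
  (forall k t s1, k < N -> frame (For x e body) s s1 -> vars s1 x = k ->
     I k t s1 ->
     wp body s1 (fun t' s2 => I k.+1 (t + t') (set_var s2 x k.+1))) ->
  (forall t s1, frame (For x e body) s s1 -> vars s1 x = N -> I N t s1 ->
     Q (t + N * (expr_cost e + 6) + (expr_cost e + 5)) s1) ->
  wp (For x e body) s Q.
Proof.
move=> x_fresh I0 eN Ibody IQ; rewrite /For; apply/wp_seq/wp_assign.
have x_in : x \in written_vars (For x e body) by rewrite /= mem_head.
pose loop := While (Bin Lt (Var x) e) (Seq body (Assign x (Succ (Var x)))).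
suff wp_loop n : forall k t s1, N - k = n -> k <= N -> vars s1 x = k ->
    frame (For x e body) s s1 -> I k t s1 ->
    wp loop s1 (fun t2 s2 => Q (t + k * (expr_cost e + 6) + 2 + t2) s2).
  apply: (wp_conseq (wp_loop N 0 0 _ _ _ _ _ I0)) => //=; first by rewrite subn0.
    by rewrite eqxx.
  exact: frame_set_var.
elim: n => [|n IHn] k t s1 kn le_kN xk fr Ik.
  have kN : k = N by lia.
  rewrite kN in xk Ik; have eN1 := eN N t s1 (leqnn _) fr xk Ik.
  apply: wp_while_false => /=; first by rewrite xk eN1 ltnn.
  have := IQ t s1 fr xk Ik; rewrite kN; congr (Q _ _); lia.
have lt_kN : k < N by lia.
apply: wp_while_true; first by rewrite /= xk (eN k t s1) // lt_kN.
apply/wp_seq/(wp_conseq (Ibody k t s1 lt_kN fr xk Ik)) => t1 s2 fr2 I2.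
apply: wp_assign => /=; have x2 : vars s2 x = k by rewrite fr2.1.
rewrite x2; apply: (wp_conseq (IHn k.+1 (t + t1) _ _ lt_kN _ _ I2)).
- lia.
- by rewrite /= eqxx.
- apply: frame_trans fr _; apply: (frame_trans (frame_for x e fr2)).
  exact: frame_set_var.
- move=> t2 s3 _; congr (Q _ _); lia.
Qed.

(** The same rule when all bodies run within a common time [C]. *)
Lemma wp_for_const x e body N C (I : nat -> state -> Prop) s
    (Q : nat -> state -> Prop) :
  x \notin written_vars body ->
  I 0 (set_var s x 0) ->
  (forall k s1, k <= N -> frame (For x e body) s s1 -> vars s1 x = k ->
     I k s1 -> eval_expr s1 e = N) ->
  (forall k s1, k < N -> frame (For x e body) s s1 -> vars s1 x = k ->
     I k s1 -> wp body s1 (fun t' s2 => t' <= C /\ I k.+1 (set_var s2 x k.+1))) ->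
  (forall t s1, frame (For x e body) s s1 -> vars s1 x = N -> I N s1 ->
     t <= N * (C + expr_cost e + 6) + (expr_cost e + 5) -> Q t s1) ->
  wp (For x e body) s Q.
Proof.
move=> x_fresh I0 eN Ibody IQ.
apply: (wp_for (N := N) (I := fun k t s => t <= k * C /\ I k s)) => //.
- by move=> k t s1 kN fr xk [_]; apply: eN.
- move=> k t s1 kN fr xk [tC Ik]; apply: (wp_conseq (Ibody k s1 kN fr xk Ik)).
  by move=> t' s2 _ [t'C I2]; split=> //; rewrite mulSn addnC leq_add.
- move=> t s1 fr xN [tC IN]; apply: IQ => //.
  by rewrite -(addnA C) (mulnDr N C) !leq_add2r.
Qed.

(** * The search programs *)

Local Notation "a ;; b" := (Seq a b) (at level 90, right associativity).

(** The scalar variables: [vU] is the outer vertex being scanned and [vV] its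
    neighbour, [vX] the base of the blossom being formed, [vHead] and [vTail]
    the vertices whose paths are joined into a new one, [vEndU] and [vEndV] the
    ends of the edge that closes an augmenting path once [vFound] is set. *)

Local Notation vD := 0 (only parsing).
Local Notation vI := 1 (only parsing).
Local Notation vJ := 2 (only parsing).
Local Notation vPhase := 3 (only parsing).
Local Notation vRound := 4 (only parsing).
Local Notation vU := 5 (only parsing).
Local Notation vV := 6 (only parsing).
Local Notation vFound := 7 (only parsing).
Local Notation vEndU := 8 (only parsing).
Local Notation vEndV := 9 (only parsing).
Local Notation vW := 10 (only parsing).
Local Notation vX := 11 (only parsing).
Local Notation vY := 12 (only parsing).
Local Notation vR := 13 (only parsing).
Local Notation vK := 14 (only parsing).
Local Notation vL := 15 (only parsing).
Local Notation vHead := 16 (only parsing).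
Local Notation vTail := 17 (only parsing).

(** The arrays. Labels are 0 for unseen, 1 for inner and 2 for outer vertices;
    row [v] of [aPATH] holds the path of the outer vertex [v], whose size is in
    [aLEN]; all other arrays but [aIN], [aADJ] and [aARC] only use row 0. *)

Local Notation aIN := 0 (only parsing).
Local Notation aF := 1 (only parsing).
Local Notation aOUT := 2 (only parsing).
Local Notation aADJ := 3 (only parsing).
Local Notation aMATE := 4 (only parsing).
Local Notation aLAB := 5 (only parsing).
Local Notation aREP := 6 (only parsing).
Local Notation aPATH := 7 (only parsing).
Local Notation aLEN := 8 (only parsing).
Local Notation aDONE := 9 (only parsing).
Local Notation aARC := 10 (only parsing).

Definition slot (a : nat) (i : expr) := Cell a (Const 0) i.
Definition store_slot (a : nat) (i e : expr) := Store a (Const 0) i e.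
Definition eNot (a : expr) := Bin Eq a (Const 0).

(** The test [~~ b < a] on truth values. *)
Definition eAnd (a b : expr) := Bin Lt (eNot b) (Bin Lt (Const 0) a).

Lemma eval_eAnd s a b :
  eval_expr s (eAnd a b) = ((eval_expr s a != 0) && (eval_expr s b != 0)).
Proof. by rewrite /=; case: (eval_expr s a) (eval_expr s b) => [|?] [|?]. Qed.

Lemma eval_eNot s a : eval_expr s (eNot a) = (eval_expr s a == 0).
Proof. by []. Qed.

Definition mate (s : state) : nat -> nat := arrs s aMATE 0.
Definition lab (s : state) : nat -> nat := arrs s aLAB 0.
Definition rep (s : state) : nat -> nat := arrs s aREP 0.
Definition len (s : state) : nat -> nat := arrs s aLEN 0.
Definition path_of (s : state) (v : nat) : seq nat :=
  mkseq (arrs s aPATH v) (len s v).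
Definition scanned (s : state) (v : nat) : bool := arrs s aDONE 0 v != 0.

Definition copy_path (y p : nat) :=
  For vK (slot aLEN (Var p))
    (Store aPATH (Var y) (Var vK) (Cell aPATH (Var p) (Var vK))).

Lemma copy_pathP y p s (Q : nat -> state -> Prop) :
  y != vK -> p != vK -> vars s y != vars s p ->
  (forall t s', frame (copy_path y p) s s' ->
     t <= 30 * (len s (vars s p)).+1 ->
     (forall i j, arrs s' aPATH i j =
        if (i == vars s y) && (j < len s (vars s p))
        then arrs s aPATH (vars s p) j else arrs s aPATH i j) -> Q t s') ->
  wp (copy_path y p) s Q.
Proof.
move=> yK pK yp IQ.
have yN : y \notin written_vars (copy_path y p) by rewrite /= !inE (negPf yK).
have pN : p \notin written_vars (copy_path y p) by rewrite /= !inE (negPf pK).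
pose I k s1 := forall i j, arrs s1 aPATH i j =
  if (i == vars s y) && (j < k) then arrs s aPATH (vars s p) j
  else arrs s aPATH i j.
apply: (wp_for_const (N := len s (vars s p)) (C := 10) (I := I)) => //.
- by move=> i j /=; rewrite ltn0 andbF.
- move=> k s1 _ [fv fa] xk Ik /=.
  by rewrite fv // fa.
- move=> k s1 _ [fv fa] xk Ik; apply: wp_store => /=; split=> //.
  have -> : vars s1 y = vars s y by rewrite fv.
  have -> : vars s1 p = vars s p by rewrite fv.
  move=> i j /=; rewrite xk !Ik (eq_sym (vars s p)) (negPf yp) /=.
  have [->|] //= := eqVneq i (vars s y).
  by rewrite ltnS; case: ltngtP => // ->.
- move=> t s1 fr _ IN tle; apply: IQ => //.
  by apply: leq_trans tle _; rewrite /=; lia.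
Qed.

Definition grow : cmd :=
  Assign vW (slot aMATE (Var vV)) ;;
  store_slot aLAB (Var vV) (Const 1) ;;
  store_slot aREP (Var vV) (Var vW) ;;
  store_slot aLAB (Var vW) (Const 2) ;;
  store_slot aREP (Var vW) (Var vW) ;;
  copy_path vW vU ;;
  Store aPATH (Var vW) (slot aLEN (Var vU)) (Var vV) ;;
  Store aPATH (Var vW) (Succ (slot aLEN (Var vU))) (Var vW) ;;
  store_slot aLEN (Var vW) (Succ (Succ (slot aLEN (Var vU)))).

Lemma mkseq_extend (f g : nat -> nat) n p :
  (forall j, j < n -> f j = g j) ->
  (forall j, j < size p -> f (n + j) = nth 0 p j) ->
  mkseq f (n + size p) = mkseq g n ++ p.
Proof.
move=> fg fp; apply: (@eq_from_nth _ 0) => [|j].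
  by rewrite size_cat !size_mkseq.
rewrite size_mkseq => lt_j; rewrite nth_mkseq // nth_cat size_mkseq.
case: ltnP => [jn|le_nj]; first by rewrite nth_mkseq // fg.
by rewrite -{1}(subnKC le_nj) fp //; lia.
Qed.

Lemma growP s (Q : nat -> state -> Prop) :
  let u := vars s vU in let v := vars s vV in let w := mate s v in
  w != u ->
  (forall t s', frame grow s s' -> t <= 30 * (len s u).+1 + 50 ->
     lab s' = upd (upd (lab s) v 1) w 2 ->
     rep s' = upd (upd (rep s) v w) w w ->
     path_of s' = upd (path_of s) w (path_of s u ++ [:: v; w]) -> Q t s') ->
  wp grow s Q.
Proof.
move=> u v w wu IQ.
suff: wp grow s (fun t s' => [/\ t <= 30 * (len s u).+1 + 50,
   lab s' = upd (upd (lab s) v 1) w 2, rep s' = upd (upd (rep s) v w) w w &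
   path_of s' = upd (path_of s) w (path_of s u ++ [:: v; w])]).
  by move=> H; apply: (wp_conseq H) => t s' fr [? ? ? ?]; apply: IQ.
do 5![apply: wp_seq; (apply: wp_assign || apply: wp_store); rewrite /=].
set s1 := set_cell _ _ _ _ _.
apply: wp_seq; apply: copy_pathP => // t s2 [fv fa] tle pathE.
do 2![apply: wp_seq; apply: wp_store]; apply: wp_store.
have s1W : vars s1 vW = w by [].
have s1U : vars s1 vU = u by [].
have s1len : arrs s1 aLEN = arrs s aLEN by [].
have s1path : arrs s1 aPATH = arrs s aPATH by [].
have s2W : vars s2 vW = w by rewrite fv.
have s2U : vars s2 vU = u by rewrite fv.
have s2V : vars s2 vV = v by rewrite fv.
have s2len : arrs s2 aLEN = arrs s aLEN by rewrite fa.
rewrite /len s1len s1U in tle pathE; rewrite s1W s1path in pathE.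
split.
- rewrite /=; rewrite /len; lia.
- apply: functional_extensionality => y; rewrite /lab /= fa //= /upd /lab.
- apply: functional_extensionality => y; rewrite /rep /= fa //= /upd /rep.
- apply: functional_extensionality => y; rewrite /path_of /len /= s2W s2U s2V s2len /upd.
  have [->|yw] /= := eqVneq y w; last first.
    by apply: eq_mkseq => j; rewrite pathE (negPf yw).
  rewrite -[(arrs s _ 0 u).+2]addn2.
  apply: (@mkseq_extend _ _ _ [:: v; w]) => [j jl|].
    by rewrite !ltn_eqF ?pathE ?eqxx ?jl // ltnW.
  case=> [|[|//]] _ /=; first by rewrite addn0 ltn_eqF ?eqxx.
  by rewrite addn1 eqxx.
Qed.

(** Writes the path of [vY]: the path of [vHead], followed backwards by the part
    of the path of [vTail] that starts at the mate of the base [vR]. *)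
Definition build_path : cmd :=
  copy_path vY vHead ;;
  Assign vL (slot aLEN (Var vHead)) ;;
  For vK (Bin Sub (slot aLEN (Var vTail)) (Bin Sub (slot aLEN (Var vR)) (Const 2)))
   (Store aPATH (Var vY) (Var vL)
      (Cell aPATH (Var vTail) (Bin Sub (slot aLEN (Var vTail)) (Succ (Var vK)))) ;;
    Assign vL (Succ (Var vL))) ;;
  store_slot aLEN (Var vY) (Var vL) ;;
  store_slot aLAB (Var vY) (Const 2).

Lemma build_pathP s (Q : nat -> state -> Prop) :
  let y := vars s vY in let p := vars s vHead in let q := vars s vTail in
  let r := vars s vR in
  y != p -> y != q ->
  (forall t s', frame build_path s s' ->
     t <= 60 * (len s p + len s q).+1 + 50 ->
     lab s' = upd (lab s) y 2 ->
     path_of s' = upd (path_of s) y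
       (path_of s p ++ rev (drop (len s r - 2) (path_of s q))) -> Q t s') ->
  wp build_path s Q.
Proof.
move=> y p q r yp yq IQ.
suff: wp build_path s (fun t s' => [/\ t <= 60 * (len s p + len s q).+1 + 50,
   lab s' = upd (lab s) y 2 & path_of s' = upd (path_of s) y
       (path_of s p ++ rev (drop (len s r - 2) (path_of s q)))]).
  by move=> H; apply: (wp_conseq H) => t s' fr [? ? ?]; apply: IQ.
apply: wp_seq; apply: copy_pathP => // t1 s1 [fv fa] t1le pathE.
apply: wp_seq; apply: wp_assign => /=.
have s1len : arrs s1 aLEN = arrs s aLEN by rewrite fa.
have s1y : vars s1 vY = y by rewrite fv.
have s1p : vars s1 vHead = p by rewrite fv.
have s1q : vars s1 vTail = q by rewrite fv.
have s1r : vars s1 vR = r by rewrite fv.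
have s1lab : arrs s1 aLAB = arrs s aLAB by rewrite fa.
rewrite -/y -/p in pathE.
rewrite s1len s1p -/(len s p); set s2 := set_var _ _ _.
pose I k s3 := vars s3 vL = len s p + k /\
  forall i j, arrs s3 aPATH i j =
   if i == y then
     if j < len s p then arrs s aPATH p j
     else if j < len s p + k then arrs s aPATH q (len s q - (j - len s p).+1)
     else arrs s aPATH i j
   else arrs s aPATH i j.
apply: wp_seq.
apply: (wp_for_const (N := len s q - (len s r - 2)) (C := 20) (I := I)) => //.
- split; first by rewrite /= addn0.
  move=> i j; rewrite [arrs _ _]/= pathE addn0.
  by case: eqP => //= ->; case: ltnP.
- move=> k s3 _ [fv3 fa3] _ [_ _] /=.
  by rewrite !fv3 // fa3 // /s2 /= s1len s1q s1r.
- move=> k s3 lt_k [fv3 fa3] xk [L3 I3]; apply: wp_seq; apply: wp_store => /=.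
  apply: wp_assign => /=; split=> //; split=> [|i j] /=.
    by rewrite L3 addnS.
  rewrite (fv3 vY) // (fv3 vTail) // (fa3 aLEN) // /s2 /= s1len s1q s1y xk L3.
  rewrite !I3 (eq_sym q) (negPf yq) -/(len s q).
  case: (eqVneq i y) => //= ->; rewrite addnS ltnS.
  case: (eqVneq j (len s p + k)) => [->|jk].
    by rewrite ltnNge leq_addr leqnn addKn.
  by rewrite (leq_eqVlt j) (negPf jk).
move=> t2 s3 [fv3 fa3] _ [L3 I3] /= t2le.
do 1![apply: wp_seq; apply: wp_store]; apply: wp_store => /=.
have s3y : vars s3 vY = y by rewrite fv3.
have s3len : arrs s3 aLEN = arrs s aLEN by rewrite fa3.
have s3lab : arrs s3 aLAB = arrs s aLAB by rewrite fa3.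
rewrite s3y.
split.
- move: (leq_subr (len s r - 2) (len s q)) t1le t2le; rewrite -/p /=.
  by move: (len s p) (len s q) (_ - (_ - 2)) => a b n le_n t1n t2n; nia.
- by apply: functional_extensionality => v; rewrite /lab /= s3lab.
- apply: functional_extensionality => v; rewrite /path_of /len /= s3len /upd L3.
  have [->|vy] /= := eqVneq v y; last first.
    by apply: eq_mkseq => j; rewrite I3 (negPf vy).
  rewrite -/(len s p) -/(len s q) -/(len s r).
  have sz : size (rev (drop (len s r - 2) (mkseq (arrs s 7 q) (len s q)))) =
      len s q - (len s r - 2).
    by rewrite size_rev size_drop size_mkseq.
  rewrite -sz; apply: mkseq_extend => j; first by rewrite I3 eqxx => ->.
  rewrite sz => jlt; rewrite I3 eqxx ltnNge leq_addr /= ltn_add2l jlt addKn.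
  rewrite nth_rev ?size_drop ?size_mkseq // nth_drop nth_mkseq; last by lia.
  by congr (arrs s 7 q _); lia.
Qed.

Definition on_path (w r : nat) : expr :=
  eAnd (eNot (Bin Lt (slot aLEN (Var w)) (slot aLEN (Var r))))
    (Bin Eq (Cell aPATH (Var w) (Bin Sub (slot aLEN (Var r)) (Const 1))) (Var r)).

Definition seen d s v := (v < d) && (lab s v != 0).
Definition outer d s v := (v < d) && (lab s v == 2).
Definition edge d s : rel nat :=
  fun u v => [&& u < d, v < d & arrs s aADJ u v != 0].

Definition search_forest d s :=
  forest d (edge d s) (mate s) (seen d s) (outer d s) (rep s) (path_of s).

Lemma on_path_raw s w r : 0 < size (path_of s r) ->
  ~~ (arrs s aLEN 0 w < arrs s aLEN 0 r) &&
    (arrs s aPATH w (arrs s aLEN 0 r - 1) == r) =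
  (size (path_of s r) <= size (path_of s w)) &&
    (nth 0 (path_of s w) (size (path_of s r)).-1 == r).
Proof.
rewrite !size_mkseq -leqNgt -!/(len s _) subn1 => r_gt0.
by case: leqP => //= le_rw; rewrite nth_mkseq //; lia.
Qed.

Lemma on_path_test d s w r :
  search_forest d s -> outer d s w -> outer d s r -> rep s r = r ->
  ~~ (arrs s aLEN 0 w < arrs s aLEN 0 r) &&
    (arrs s aPATH w (arrs s aLEN 0 r - 1) == r) =
  prefix (path_of s r) (path_of s w).
Proof.
move=> F ow or rr; have /andP[r_gt0 _] := path_size F or.
by rewrite (base_on_pathP F) // on_path_raw.
Qed.

(** The search starts from the root, which both paths share. *)
Definition find_base : cmd :=
  Assign vX (Cell aPATH (Var vU) (Const 0)) ;;
  For vY (Var vD)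
    (If (eAnd (Bin Eq (slot aLAB (Var vY)) (Const 2))
        (eAnd (Bin Eq (slot aREP (Var vY)) (Var vY))
        (eAnd (on_path vU vY)
        (eAnd (on_path vV vY)
              (Bin Lt (slot aLEN (Var vX)) (slot aLEN (Var vY)))))))
      (Assign vX (Var vY)) Skip).

Definition greatest_common_base d s u v x :=
  [/\ outer d s x, rep s x = x,
      prefix (path_of s x) (path_of s u), prefix (path_of s x) (path_of s v) &
      forall y, outer d s y -> rep s y = y ->
        prefix (path_of s y) (path_of s u) ->
        prefix (path_of s y) (path_of s v) ->
        size (path_of s y) <= size (path_of s x)].

Lemma path_start d s v : search_forest d s -> outer d s v ->
  nth 0 (path_of s v) 0 = arrs s aPATH v 0.
Proof.
move=> F ov; have /andP[v_gt0 _] := path_size F ov.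
by rewrite nth_mkseq // -(size_mkseq (arrs s aPATH v) (len s v)).
Qed.

Lemma find_baseP d s (Q : nat -> state -> Prop) :
  let u := vars s vU in let v := vars s vV in
  search_forest d s -> vars s vD = d -> outer d s u -> outer d s v ->
  arrs s aPATH u 0 = arrs s aPATH v 0 ->
  (forall t s', frame find_base s s' -> t <= 120 * d.+1 ->
     greatest_common_base d s u v (vars s' vX) -> Q t s') ->
  wp find_base s Q.
Proof.
move=> u v F dE ou ov roots IQ.
suff: wp find_base s (fun t s' => t <= 120 * d.+1 /\
     greatest_common_base d s u v (vars s' vX)).
  by move=> H; apply: (wp_conseq H) => t s' fr [? ?]; apply: IQ.
apply: wp_seq; apply: wp_assign => /=.
set s0 := set_var _ _ _.
pose common x := [&& outer d s x, rep s x == x,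
      prefix (path_of s x) (path_of s u) & prefix (path_of s x) (path_of s v)].
pose I k s1 := common (vars s1 vX) /\
  forall y, y < k -> common y -> size (path_of s y) <= size (path_of s (vars s1 vX)).
apply: (wp_for_const (N := d) (C := 100) (I := I)) => //.
- split=> //=; rewrite -/u -(path_start F ou).
  have [ox rx xu _] := root_base F ou; rewrite /common ox rx eqxx xu /=.
  rewrite (path_start F ou) roots -(path_start F ov).
  by have [] := root_base F ov.
- by move=> k s1 _ [fv fa] _ _ /=; rewrite fv.
- move=> k s1 lt_kd [fv fa] yk [cx maxx].
  have arrsE : arrs s1 = arrs s by apply: functional_extensionality => a; rewrite fa.
  have pathE : path_of s1 = path_of s by rewrite /path_of /len arrsE.
  have s1U : vars s1 vU = u by rewrite fv.
  have s1V : vars s1 vV = v by rewrite fv.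
  apply: (wp_if_bool (b := common k &&
     (size (path_of s (vars s1 vX)) < size (path_of s k)))).
  + rewrite !eval_eAnd !eqb0 !negbK /common /outer lt_kd /=.
    rewrite yk s1U s1V arrsE -/(lab s k) -/(rep s k).
    case: eqP => //= labk; case: eqP => //= repk.
    have ok : outer d s k by rewrite /outer lt_kd labk eqxx.
    by rewrite !(on_path_test F) // -!andbA !size_mkseq.
  + move=> /andP[ck lt_xk]; apply: wp_assign => /=; split=> //; split; rewrite /= yk //.
    move=> y; rewrite ltnS leq_eqVlt => /predU1P[-> //|lt_yk cy].
    by apply: leq_trans (ltnW lt_xk); apply: maxx.
  + rewrite negb_and => nck; apply: wp_skip; split=> //; split=> //= y.
    rewrite ltnS leq_eqVlt => /predU1P[-> ck|]; last exact: maxx.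
    by move: nck; rewrite ck /= -leqNgt.
- move=> t s1 fr yd [/and4P[ox /eqP rx xu xv] maxx] tle; split.
    by rewrite /= in tle; lia.
  split=> // y oy ry yu yv; apply: maxx; first by case/andP: oy.
  by rewrite /common oy ry eqxx yu yv.
Qed.

Definition nonouter d s := count (fun v => lab s v != 2) (iota 0 d).

(** Each vertex that becomes outer lowers the bound on the paths still to be
    written. *)
Lemma nonouter_lt d s s' y :
  (forall v, v < d -> lab s v = 2 -> lab s' v = 2) ->
  y < d -> lab s y != 2 -> lab s' y = 2 -> nonouter d s' < nonouter d s.
Proof.
move=> mono yd ys ys'; rewrite /nonouter -!size_filter -[_.+1]/(size (y :: _)).
apply: uniq_leq_size.
  by rewrite /= filter_uniq ?iota_uniq // mem_filter ys' eqxx.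
move=> v; rewrite inE !mem_filter !mem_vertices => /predU1P[->|/andP[vs' vd]].
  by rewrite ys.
by rewrite vd andbT; apply: contra vs' => /eqP/mono ->.
Qed.

(** Moves the vertex [vY] to the class of [vX]; an inner vertex becomes outer. *)
Definition absorb (head tail : nat) : cmd :=
  Assign vHead (Var head) ;;
  Assign vTail (Var tail) ;;
  If (Bin Eq (slot aLAB (Var vY)) (Const 2)) Skip build_path ;;
  store_slot aREP (Var vY) (Var vX).

Lemma absorbP head tail s (Q : nat -> state -> Prop) :
  head \notin [:: vHead; vTail] -> tail \notin [:: vHead; vTail] ->
  let y := vars s vY in let p := vars s head in let q := vars s tail in
  (lab s y != 2 -> y != p /\ y != q) ->
  (forall t s', frame (absorb head tail) s s' ->
     t <= (if lab s y == 2 then 30 else 60 * (len s p + len s q).+1 + 80) ->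
     lab s' = upd (lab s) y 2 -> rep s' = upd (rep s) y (vars s vX) ->
     path_of s' = (if lab s y == 2 then path_of s else upd (path_of s) y
       (path_of s p ++ rev (drop (len s (vars s vR) - 2) (path_of s q)))) -> Q t s') ->
  wp (absorb head tail) s Q.
Proof.
move=> head_fresh tail_fresh y p q ypq IQ.
suff: wp (absorb head tail) s (fun t s' => [/\
     t <= (if lab s y == 2 then 30 else 60 * (len s p + len s q).+1 + 80),
     lab s' = upd (lab s) y 2, rep s' = upd (rep s) y (vars s vX) &
     path_of s' = (if lab s y == 2 then path_of s else upd (path_of s) y
       (path_of s p ++ rev (drop (len s (vars s vR) - 2) (path_of s q))))]).
  by move=> H; apply: (wp_conseq H) => t s' fr [? ? ? ?]; apply: IQ.
move: head_fresh tail_fresh; rewrite !inE !negb_or => /andP[hH hT] /andP[tH tT].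
do 2![apply: wp_seq; apply: wp_assign; rewrite /=].
rewrite (negPf tH) -/p -/q; set s1 := set_var _ _ _.
apply: wp_seq; apply: (wp_if_bool (b := lab s y == 2)) => //= laby.
  rewrite laby; apply: wp_skip; apply: wp_store => /=; split=> //.
  apply: functional_extensionality => v; rewrite /lab /upd /=.
  by have [->|//] := eqVneq v _; apply/eqP.
have [yp yq] := ypq laby.
rewrite (negPf laby); apply: build_pathP => // t s2 [fv fa] tle labE pathE.
apply: wp_store => /=.
have s2Y : vars s2 vY = y by rewrite fv.
have s2X : vars s2 vX = vars s vX by rewrite fv.
split.
- by move: tle; rewrite /len /s1 /= -/p -/q; lia.
- by rewrite /lab /= -/(lab s2) labE.
- by apply: functional_extensionality => v; rewrite /rep /= fa // s2Y s2X.
- exact: pathE.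
Qed.

(** A base lies on a path if and only if it stands where its own path ends, so
    that each vertex is tested in constant time. *)
Definition relabel : cmd :=
  For vY (Var vD)
    (If (eNot (Bin Eq (slot aLAB (Var vY)) (Const 0)))
      (Assign vR (slot aREP (Var vY)) ;;
       If (Bin Lt (slot aLEN (Var vX)) (slot aLEN (Var vR)))
         (If (on_path vU vR) (absorb vV vU)
           (If (on_path vV vR) (absorb vU vV) Skip))
         Skip)
      Skip).

Section Relabel.

Variables (d : nat) (s : state).
Let u := vars s vU.
Let v := vars s vV.
Let x := vars s vX.
Hypotheses (F : search_forest d s) (dE : vars s vD = d).
Hypotheses (ou : outer d s u) (ov : outer d s v).
Hypotheses (ox : outer d s x).

Let abs := absorbed (path_of s) u v x.
Let new_rep := contract_rep (seen d s) (rep s) (path_of s) u v x.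
Let new_outer := contract_outer (seen d s) (outer d s) (rep s) (path_of s) u v x.
Let new_path := contract_path (seen d s) (outer d s) (rep s) (path_of s) u v x.

(** The state after the vertices below [k] have been treated. The tests do not
    depend on this progress: they only read the representative of the vertex
    itself and the paths of vertices that were already outer. *)
Definition relabeled k s1 :=
  [/\ lab s1 = (fun y => if (y < k) && new_outer y then 2 else lab s y),
      rep s1 = (fun y => if y < k then new_rep y else rep s y) &
      path_of s1 = (fun y => if y < k then new_path y else path_of s y)].

Lemma relabelP (Q : nat -> state -> Prop) :
  (forall t s', frame relabel s s' ->
     t + 1000 * d * nonouter d s' <= 400 * d.+1 + 1000 * d * nonouter d s ->
     relabeled d s' -> Q t s') ->
  wp relabel s Q.
Proof.
move=> IQ.
suff: wp relabel s (fun t s' =>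
     t + 1000 * d * nonouter d s' <= 400 * d.+1 + 1000 * d * nonouter d s /\
     relabeled d s').
  by move=> H; apply: (wp_conseq H) => t s' fr [? ?]; apply: IQ.
pose I k t s1 := t + 1000 * d * nonouter d s1 <= k * 300 + 1000 * d * nonouter d s /\
  relabeled k s1.
have step k y : (y < k.+1) = (y < k) || (y == k) by rewrite ltnS leq_eqVlt orbC.
apply: (wp_for (N := d) (I := I)) => //.
- by move=> k t s1 _ [fv fa] _ _ /=; rewrite fv.
- move=> k t s1 lt_kd [fv fa] yk [tle [labE repE pathE]].
  have s1U : vars s1 vU = u by rewrite fv.
  have s1V : vars s1 vV = v by rewrite fv.
  have s1X : vars s1 vX = x by rewrite fv.
  have labk : lab s1 k = lab s k by rewrite labE ltnn.
  have repk : rep s1 k = rep s k by rewrite repE ltnn.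
  have path_outer y : outer d s y -> path_of s1 y = path_of s y.
    by move=> oy; rewrite pathE; case: ifP => // _; apply: contract_path_outer.
  have skip : ~~ (seen d s k && abs (rep s k)) -> relabeled k.+1 s1.
    move=> nk; split; apply: functional_extensionality => y; rewrite ?labE ?repE ?pathE step.
    + have [->|_] := eqVneq y k; last by rewrite orbF.
      rewrite orbT ltnn /= /new_outer /contract_outer.
      by rewrite (negPf nk) orbF /outer; case: ifP => // /andP[_ /eqP].
    + have [->|_] := eqVneq y k; last by rewrite orbF.
      rewrite orbT ltnn /new_rep /contract_rep.
      by rewrite (negPf nk).
    + have [->|_] := eqVneq y k; last by rewrite orbF.
      rewrite orbT ltnn /new_path /contract_path.
      by rewrite andbCA (negPf nk) andbF.
  have skipI t' : t' <= 150 -> ~~ (seen d s k && abs (rep s k)) ->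
      I k.+1 (t + t') (set_var s1 vY k.+1).
    move=> t'le nk; split; last exact: skip.
    by rewrite -[nonouter d _]/(nonouter d s1) mulSn; lia.
  apply: (wp_if_bool (b := seen d s k)).
  + by rewrite /= yk -/(lab s1 k) labk eqb0 /seen lt_kd.
  + move=> sk; have [or rr] := rep_base F sk.
    have /andP[r_gt0 _] := path_size F or.
    have r_lt : rep s k < d := forest_lt F (forest_seen F or).
    apply: wp_seq; apply: wp_assign; rewrite [eval_expr _ _]/= yk -/(rep s1 k) repk.
    set s2 := set_var _ _ _.
    have lenE y : outer d s y -> arrs s1 aLEN 0 y = size (path_of s y).
      by move=> oy; rewrite -path_outer // size_mkseq.
    have onp w : outer d s w ->
       ~~ (arrs s1 aLEN 0 w < arrs s1 aLEN 0 (rep s k)) &&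
    (arrs s1 aPATH w (arrs s1 aLEN 0 (rep s k) - 1) == rep s k) =
       prefix (path_of s (rep s k)) (path_of s w).
      move=> ow; rewrite on_path_raw !path_outer //.
      by rewrite (base_on_pathP F).
    (* The two sides of the blossom are handled alike. *)
    have absorb_side head tail w w' :
        head \notin [:: vHead; vTail] -> tail \notin [:: vHead; vTail] ->
        vars s2 head = w' -> vars s2 tail = w -> outer d s w -> outer d s w' ->
        abs (rep s k) ->
        (if prefix (path_of s (rep s k)) (path_of s u)
         then path_of s v ++ rev (tail_from (path_of s) (rep s k) u)
         else path_of s u ++ rev (tail_from (path_of s) (rep s k) v)) =
           path_of s w' ++ rev (tail_from (path_of s) (rep s k) w) ->
        wp (absorb head tail) s2 (fun t' s' => forall t'', t'' <= 100 + t' ->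
          I k.+1 (t + t'') (set_var s' vY k.+1)).
      move=> hf tf hE tE ow ow' ab newE.
      have s2Y : vars s2 vY = k by [].
      have sk_abs : seen d s k && abs (rep s k) by rewrite sk ab.
      apply: absorbP => //.
        rewrite s2Y hE tE -[lab s2]/(lab s1) labk => nk.
        have diff y : outer d s y -> k != y.
          by move=> /andP[_ /eqP ly]; apply: contraNneq nk => ->; rewrite ly.
        by split; apply: diff.
      move=> t' s' [fv' fa'].
      rewrite s2Y hE tE -[lab s2]/(lab s1) -[rep s2]/(rep s1) -[path_of s2]/(path_of s1).
      rewrite -[vars s2 vX]/(vars s1 vX) -[vars s2 vR]/(rep s k) s1X labk.
      rewrite -[len s2]/(len s1) /len !lenE // !path_outer // => t'le labE' repE' pathE' t'' t''le.
      have lab'k : lab s' k = 2 by rewrite labE' /upd eqxx.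
      have rel : relabeled k.+1 s'.
        split; apply: functional_extensionality => y;
          rewrite ?labE' ?repE' ?pathE' step.
        - rewrite /upd; have [->|yk'] := eqVneq y k; last by rewrite orbF labE.
          by rewrite orbT /new_outer /contract_outer sk_abs orbT.
        - rewrite /upd; have [->|yk'] := eqVneq y k; last by rewrite orbF repE.
          by rewrite orbT /new_rep /contract_rep sk_abs.
        - have [->|yk'] := eqVneq y k; last first.
            by rewrite orbF; case: ifP => _; rewrite ?/upd ?(negPf yk') pathE.
          rewrite orbT /new_path /contract_path sk
            (ab : absorbed (path_of s) u v x (rep s k)) andbT /outer lt_kd /=.
          case: ifP => [_|_] /=; first by rewrite pathE ltnn.
          by rewrite /upd eqxx newE.
      split; last exact: rel.
      have mono y : y < d -> lab s1 y = 2 -> lab s' y = 2.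
        by move=> _ ly; rewrite labE' /upd; case: ifP.
      rewrite -[nonouter d (set_var _ _ _)]/(nonouter d s').
      have [/eqP k2|k2] := boolP (lab s k == 2).
        have same : nonouter d s' = nonouter d s1.
          apply: eq_count => y; rewrite labE' /upd.
          by case: (eqVneq y k) => // ->; rewrite labk k2.
        by move: tle t'le t''le; rewrite same k2 eqxx mulSn; clear; lia.
      have lt_n : nonouter d s' < nonouter d s1.
        by apply: (nonouter_lt mono lt_kd) => //; rewrite labk.
      have /andP[_ sw] := path_size F ow; have /andP[_ sw'] := path_size F ow'.
      move: t'le; rewrite (negPf k2) => t'le.
      move: (leq_mul (leqnn (1000 * d)) lt_n) tle t'le t''le sw sw' lt_kd.
      by rewrite mulnS mulSn; clear; lia.
    have ab_uv w : (w = u) \/ (w = v) -> size (path_of s x) < size (path_of s (rep s k)) ->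
        prefix (path_of s (rep s k)) (path_of s w) -> abs (rep s k).
      by move=> w_uv lt_xr pre; rewrite /abs /absorbed lt_xr; case: w_uv pre => <- ->;
        rewrite ?orbT.
    apply: (wp_if_bool (b := size (path_of s x) < size (path_of s (rep s k)))).
    * by rewrite /= s1X !lenE.
    * move=> lt_xr; apply: (wp_if_bool (b := prefix (path_of s (rep s k)) (path_of s u))).
      - rewrite eval_eAnd !eqb0 !negbK /=. by rewrite s1U -(onp u ou).
      - move=> pre; have ab := ab_uv u (or_introl erefl) lt_xr pre.
        apply: (wp_conseq (absorb_side vV vU u v _ _ _ _ _ _ ab _)) => //; first by rewrite pre.
        by move=> t' s' _; apply; clear => /=; lia.
      move=> npre; apply: (wp_if_bool (b := prefix (path_of s (rep s k)) (path_of s v))).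
      - by rewrite eval_eAnd !eqb0 !negbK /= s1V -(onp v ov).
      - move=> pre; have ab := ab_uv v (or_intror erefl) lt_xr pre.
        apply: (wp_conseq (absorb_side vU vV v u _ _ _ _ _ _ ab _)) => //.
          by rewrite (negPf npre).
        by move=> t' s' _; apply; clear => /=; lia.
      move=> npre'; apply: wp_skip; apply: skipI => //.
      by rewrite /abs /absorbed (negPf npre) (negPf npre') !andbF.
    * move=> nlt; apply: wp_skip; apply: skipI => //.
      by rewrite /abs /absorbed (negPf nlt) andbF.
  + by move=> nk; apply: wp_skip; apply: skipI => //; rewrite (negPf nk).
- move=> t s1 fr yd [tle rel]; split=> //.
  by rewrite /=; lia.
Qed.

End Relabel.

Definition contract : cmd := find_base ;; relabel.

Definition process : cmd :=
  If (Bin Eq (slot aLAB (Var vV)) (Const 0)) grow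
    (If (eAnd (Bin Eq (slot aLAB (Var vV)) (Const 2))
          (eNot (Bin Eq (slot aREP (Var vU)) (slot aREP (Var vV)))))
      (If (Bin Eq (Cell aPATH (Var vU) (Const 0)) (Cell aPATH (Var vV) (Const 0)))
        contract
        (Assign vFound (Const 1) ;;
         Assign vEndU (Var vU) ;;
         Assign vEndV (Var vV)))
      Skip).

(** What a step of the search preserves. *)
Definition extends d s s' :=
  [/\ forall y, seen d s y -> seen d s' y,
      forall y, outer d s y -> outer d s' y &
      forall y z, seen d s y -> seen d s z -> rep s y = rep s z -> rep s' y = rep s' z].

Lemma extends_trans d s1 s2 s3 :
  extends d s1 s2 -> extends d s2 s3 -> extends d s1 s3.
Proof.
move=> [a b c] [a' b' c']; split=> [y /a/a'|y /b/b'|y z sy sz rr] //.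
by apply: c'; [apply: a|apply: a|apply: c].
Qed.

(** The time set aside for the vertices that are still to become outer. *)
Definition potential d s := 3000 * d * nonouter d s.

(** The two ends of an augmenting path. *)
Definition found_ends d s :=
  let u := vars s vEndU in let v := vars s vEndV in
  [/\ outer d s u, outer d s v, edge d s u v &
      nth 0 (path_of s u) 0 != nth 0 (path_of s v) 0].

Section Search.

Variables (d : nat).

Section Process.

Variable s : state.
Let u := vars s vU.
Let v := vars s vV.
Hypotheses (F : search_forest d s) (dE : vars s vD = d).
Hypotheses (mm : matching d (edge d s) (mate s)) (e_sym : symmetric (edge d s)).
Hypotheses (ou : outer d s u) (euv : edge d s u v).

Let ud : u < d. Proof. by case/andP: ou. Qed.
Let vd : v < d. Proof. by case/and3P: euv. Qed.

Lemma contractP (Q : nat -> state -> Prop) :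
  outer d s v -> rep s u != rep s v -> arrs s aPATH u 0 = arrs s aPATH v 0 ->
  (forall t s', frame contract s s' ->
     t + potential d s' + 100 <= potential d s ->
     search_forest d s' -> extends d s s' -> rep s' u = rep s' v -> Q t s') ->
  wp contract s Q.
Proof.
move=> ov ruv roots IQ.
suff: wp contract s (fun t s' =>
    [/\ t + potential d s' + 100 <= potential d s, search_forest d s', extends d s s' &
        rep s' u = rep s' v]).
  by move=> H; apply: (wp_conseq H) => t s' fr [? ? ? ?]; apply: IQ.
apply: wp_seq; apply: (find_baseP F dE ou ov roots) => t1 s1 [fv fa] t1le.
rewrite -/u -/v; set x := vars s1 vX => -[ox rx xu xv xmax].
have arrsE : arrs s1 = arrs s by apply: functional_extensionality => a; rewrite fa.
have pathE : path_of s1 = path_of s by rewrite /path_of /len arrsE.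
have s1U : vars s1 vU = u by rewrite fv.
have s1V : vars s1 vV = v by rewrite fv.
have outerE : outer d s1 = outer d s by rewrite /outer /lab arrsE.
have seenE : seen d s1 = seen d s by rewrite /seen /lab arrsE.
have repE : rep s1 = rep s by rewrite /rep arrsE.
have F1 : search_forest d s1.
  by rewrite /search_forest /edge /mate outerE seenE repE pathE arrsE.
apply: (relabelP F1); rewrite ?s1U ?s1V ?outerE //; first by rewrite fv // dE.
move=> t2 s2 [fv2 fa2] t2le.
rewrite /relabeled s1U s1V outerE seenE repE pathE -/x => -[labE2 repE2 pathE2].
have seen2 : seen d s2 = seen d s.
  apply: functional_extensionality => y; rewrite /seen labE2.
  case: (ltnP y d) => //= yd; case: ifP => [|_]; last by rewrite /lab arrsE.
  by move=> /(contract_outer_seen F); rewrite /seen yd /= => ->.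
have outer2 : outer d s2 = contract_outer (seen d s) (outer d s) (rep s) (path_of s) u v x.
  apply: functional_extensionality => y.
  rewrite -[LHS]/((y < d) && (lab s2 y == 2)) labE2.
  case: (ltnP y d) => /= yd; last first.
    by apply/esym/negbTE/negP => /(contract_outer_seen F); rewrite /seen ltnNge yd.
  case nc: (contract_outer _ _ _ _ _ _ _ y) => //; move: nc => /negbT.
  rewrite /contract_outer negb_or /outer yd /= => /andP[nl _].
  by rewrite /lab arrsE (negPf nl).
have rep2 : rep s2 = contract_rep (seen d s) (rep s) (path_of s) u v x.
  apply: functional_extensionality => y; rewrite repE2; case: ltnP => // yd.
  by rewrite /contract_rep /seen ltnNge yd.
have path2 : path_of s2 = contract_path (seen d s) (outer d s) (rep s) (path_of s) u v x.
  apply: functional_extensionality => y; rewrite pathE2; case: ltnP => // yd.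
  by rewrite /contract_path /seen ltnNge yd.
have edge2 : edge d s2 = edge d s by rewrite /edge fa2 // arrsE.
have mate2 : mate s2 = mate s by rewrite /mate fa2 // arrsE.
split.
- have [y [yd noy oy]] := contract_progress mm F ou ov ox rx xu xv ruv.
  have lt_n : nonouter d s2 < nonouter d s.
    apply: (@nonouter_lt _ _ _ y) => //.
    + move=> w wd lw; have : outer d s2 w; last by case/andP => _ /eqP.
      by rewrite outer2 /contract_outer /outer wd lw eqxx.
    + by move: noy; rewrite /outer yd.
    + by move: oy; rewrite -outer2 => /andP[_ /eqP].
  have n1 : nonouter d s1 = nonouter d s by rewrite /nonouter /lab arrsE.
  rewrite n1 in t2le.
  have := leq_mul (leqnn (2000 * d)) lt_n; rewrite /potential mulnS; lia.
- rewrite /search_forest edge2 mate2 seen2 outer2 rep2 path2.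
  exact: forest_contract.
- split.
  + by rewrite seen2.
  + by rewrite outer2 => y; apply: contract_outer_mono.
  + by move=> y z sy sz rr; rewrite rep2 /contract_rep sy sz rr.
- by rewrite rep2 !(contract_end F); auto.
Qed.

Lemma processP (Q : nat -> state -> Prop) :
  vars s vFound = 0 ->
  (forall t s', frame process s s' ->
     t + potential d s' <= 200 + potential d s ->
     search_forest d s' -> extends d s s' ->
     (vars s' vFound != 0 -> found_ends d s') ->
     (vars s' vFound = 0 -> seen d s' v /\ (outer d s v -> rep s' u = rep s' v)) ->
     Q t s') ->
  wp process s Q.
Proof.
move=> nfound IQ.
suff: wp process s (fun t s' =>
    [/\ t + potential d s' <= 200 + potential d s, search_forest d s', extends d s s',
     vars s' vFound != 0 -> found_ends d s' &
     vars s' vFound = 0 -> seen d s' v /\ (outer d s v -> rep s' u = rep s' v)]).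
  by move=> H; apply: (wp_conseq H) => t s' fr [? ? ? ? ?]; apply: IQ.
apply: (wp_if_bool (b := lab s v == 0)) => // [/eqP lv0|lv].
  have nsv : ~~ seen d s v by rewrite /seen lv0 andbF.
  have nov : ~~ outer d s v by rewrite /outer lv0 andbF.
  have [wd mw _] := mm vd; set w := mate s v in wd mw.
  have nsw : ~~ seen d s w.
    by apply: contra nsv => sw; rewrite -mw; have [_ _ sm _] := forest_rep F sw.
  have su : seen d s u := forest_seen F ou.
  have wu : w != u by apply: contraNneq nsw => ->.
  have wv : w != v.
    by apply: contraNneq nov => wv; have [] := forest_exposed F vd wv.
  apply: growP => // t s' [fv fa] tle; rewrite -/u -/v -/w => labE repE pathE.
  have seenE : seen d s' = (fun y => [|| seen d s y, y == v | y == w]).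
    apply: functional_extensionality => y; rewrite /seen labE /upd.
    have [->|yw] := eqVneq y w; first by rewrite wd !orbT.
    by have [->|yv] := eqVneq y v; rewrite ?vd ?orbT ?orbF.
  have outerE : outer d s' = (fun y => outer d s y || (y == w)).
    apply: functional_extensionality => y; rewrite /outer labE /upd.
    have [->|yw] := eqVneq y w; first by rewrite wd !orbT.
    by have [->|yv] := eqVneq y v; rewrite ?orbF // lv0 !andbF.
  have F' : search_forest d s'.
    rewrite /search_forest /edge /mate !fa // seenE outerE repE pathE.
    exact: forest_grow.
  have lenu : len s u <= d.
    by have /andP[_] := path_size F ou; rewrite size_mkseq.
  split=> //.
  - have lt_n : nonouter d s' < nonouter d s.
      apply: (@nonouter_lt _ _ _ w) => //.
      + move=> y yd ly; rewrite labE /upd; case: ifP => // _.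
        by have [yv|//] := eqVneq y v; rewrite yv lv0 in ly.
      + by move: nsw; rewrite /seen wd /= negbK => /eqP ->.
      + by rewrite labE /upd eqxx.
    have := leq_mul (leqnn (3000 * d)) lt_n; rewrite /potential mulnS /=.
    by rewrite -/u in tle; move: vd; lia.
  - split.
    + by move=> y; rewrite seenE => ->.
    + by move=> y; rewrite outerE => ->.
    + move=> y z sy sz; rewrite repE /upd.
      have [yw|_] := eqVneq y w; first by rewrite -yw sy in nsw.
      have [yv|_] := eqVneq y v; first by rewrite -yv sy in nsv.
      have [zw|_] := eqVneq z w; first by rewrite -zw sz in nsw.
      by have [zv|_] := eqVneq z v; first by rewrite -zv sz in nsv.
  - by rewrite fv // nfound.
  - by move=> _; split; [rewrite seenE eqxx orbT|move=> ov; rewrite ov in nov].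
have sv : seen d s v by rewrite /seen vd lv.
apply: (wp_if_bool (b := outer d s v && (rep s u != rep s v))).
- by rewrite eval_eAnd /= !eqb0 !negbK /outer vd.
- move=> /andP[ov ruv].
  apply: (wp_if_bool (b := arrs s aPATH u 0 == arrs s aPATH v 0)) => // [/eqP roots|roots].
    apply: contractP => // t s' [fv fa] tle F' ext ruv'; split=> //.
    + by move: tle; rewrite /=; lia.
    + by rewrite fv // nfound.
    + by split=> //; have [seen_ext _ _] := ext; apply: seen_ext.
  do 2![apply: wp_seq; apply: wp_assign => /=]; apply: wp_assign => /=; split=> //.
  + by rewrite -[potential d (set_var _ _ _)]/(potential d s); lia.
  + by move=> _; split=> //=; rewrite !(path_start F).
- move=> nov; apply: wp_skip; split=> //.
  + by rewrite /=; lia.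
  + by rewrite nfound.
  + by move=> _; split=> // ov; move: nov; rewrite ov /= negbK => /eqP.
Qed.

End Process.

End Search.

(** * The search phases *)

Definition scan : cmd :=
  For vV (Var vD)
    (If (eAnd (Cell aADJ (Var vU) (Var vV)) (eNot (Var vFound))) process Skip).

Section Scan.

Variables (d : nat) (s : state).
Let u := vars s vU.
Hypotheses (F : search_forest d s) (dE : vars s vD = d).
Hypotheses (mm : matching d (edge d s) (mate s)) (e_sym : symmetric (edge d s)).
Hypotheses (ou : outer d s u).

Lemma scanP (Q : nat -> state -> Prop) :
  (vars s vFound != 0 -> found_ends d s) ->
  (forall t s', frame scan s s' ->
     t + potential d s' <= 300 * d.+1 + potential d s ->
     search_forest d s' -> extends d s s' ->
     (vars s' vFound != 0 -> found_ends d s') ->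
     (vars s' vFound = 0 -> vars s vFound = 0) ->
     (vars s' vFound = 0 -> forall b, edge d s u b ->
        seen d s' b /\ (outer d s b -> rep s' u = rep s' b)) ->
     Q t s') ->
  wp scan s Q.
Proof.
move=> found IQ.
pose I k t s1 := [/\ t + potential d s1 <= k * 250 + potential d s,
  search_forest d s1, extends d s s1,
  vars s1 vFound != 0 -> found_ends d s1 &
  vars s1 vFound = 0 -> vars s vFound = 0 /\ forall b, b < k -> edge d s u b ->
        seen d s1 b /\ (outer d s b -> rep s1 u = rep s1 b)].
apply: (wp_for (N := d) (I := I)) => //.
- by move=> k t s1 _ [fv fa] _ _; rewrite /= fv.
- move=> k t s1 lt_kd [fv fa] xk [tle F1 ext1 fnd1 clo1].
  have s1U : vars s1 vU = u by rewrite fv.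
  have edge1 : edge d s1 = edge d s by rewrite /edge fa.
  have mate1 : mate s1 = mate s by rewrite /mate fa.
  have su : seen d s u := forest_seen F ou.
  have [seen1 outer1 _] := ext1.
  apply: (wp_if_bool (b := edge d s u k && (vars s1 vFound == 0))).
  + rewrite eval_eAnd /= s1U xk eqb0 negbK (fa aADJ) // /edge lt_kd.
    by case/andP: ou => ->.
  + move=> /andP[euk /eqP nf].
    apply: (@processP d s1) => //; rewrite ?s1U ?xk ?edge1 ?mate1 //.
    * by rewrite fv.
    * exact: outer1.
    move=> t' s2 [fv2 fa2] t'le F2 ext2 fnd2 clo2; split=> //.
    * by rewrite -[potential d (set_var _ _ _)]/(potential d s2) /= mulSn; lia.
    * exact: extends_trans ext1 ext2.
    * have [_ _ rep2] := ext2; have [seen2 _ _] := ext2.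
      move=> nf2; have [nfs clo] := clo1 nf; split=> // b.
      rewrite ltnS leq_eqVlt => /predU1P[->|lt_bk] eub.
        by have [sk rk] := clo2 nf2; split=> // /outer1.
      have [sb rb] := clo b lt_bk eub; split; first exact: seen2.
      by move=> /rb; apply: rep2 => //; apply: seen1.
  + move=> nproc; apply: wp_skip; split=> //.
    * by rewrite -[potential d (set_var _ _ _)]/(potential d s1) /= mulSn; lia.
    * move=> nf; have [nfs clo] := clo1 nf; split=> // b.
      rewrite ltnS leq_eqVlt => /predU1P[->|]; last exact: clo.
      by move: nproc; rewrite [vars s1 _]nf andbT => /negPf->.
- move=> t s1 fr _ [tle F1 ext1 fnd1 clo1]; apply: IQ => //.
  + by rewrite /=; lia.
  + by case/clo1.
  + by move=> /clo1[_ clo] b eub; apply: clo => //; case/and3P: eub.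
Qed.

End Scan.

Definition pick_unscanned : cmd :=
  Assign vU (Var vD) ;;
  For vI (Var vD)
    (If (eAnd (Bin Eq (slot aLAB (Var vI)) (Const 2)) (eNot (slot aDONE (Var vI))))
      (Assign vU (Var vI)) Skip).

Lemma pick_unscannedP d s (Q : nat -> state -> Prop) :
  vars s vD = d ->
  (forall t s', frame pick_unscanned s s' -> t <= 50 * d.+1 ->
     (if vars s' vU < d
      then is_true (outer d s (vars s' vU) && ~~ scanned s (vars s' vU))
      else forall y, outer d s y -> scanned s y) -> Q t s') ->
  wp pick_unscanned s Q.
Proof.
move=> dE IQ.
suff: wp pick_unscanned s (fun t s' => t <= 50 * d.+1 /\
     (if vars s' vU < d
      then is_true (outer d s (vars s' vU) && ~~ scanned s (vars s' vU))
      else forall y, outer d s y -> scanned s y)).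
  by move=> H; apply: (wp_conseq H) => t s' fr [? ?]; apply: IQ.
apply: wp_seq; apply: wp_assign; rewrite /= dE; set s0 := set_var _ _ _.
pose I k s1 :=
  (if vars s1 vU < d then is_true (outer d s (vars s1 vU) && ~~ scanned s (vars s1 vU))
   else forall y, y < k -> outer d s y -> scanned s y).
apply: (wp_for_const (N := d) (C := 30) (I := I)) => //.
- by rewrite /I /= ltnn.
- by move=> k s1 _ [fv fa] _ _; rewrite /= fv.
- move=> k s1 lt_kd [fv fa] xk Ik.
  apply: (wp_if_bool (b := outer d s k && ~~ scanned s k)).
  + rewrite eval_eAnd /= xk !fa //. by rewrite !eqb0 /outer /scanned lt_kd !negbK.
  + move=> new; apply: wp_assign => /=; split=> //.
    by rewrite /I /= xk lt_kd.
  + move=> old; apply: wp_skip; split=> //; rewrite /I /=.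
    move: Ik; rewrite /I; case: ifP => // _ Ik y; rewrite ltnS leq_eqVlt.
    move=> /predU1P[-> oy|]; last exact: Ik.
    by move: old; rewrite oy /= negbK.
- move=> t s1 fr _ Id tle; split; first by rewrite /= in tle *; lia.
  move: Id; rewrite /I; case: ifP => // _ Id y oy.
  by apply: Id => //; case/andP: oy.
Qed.

Definition search : cmd :=
  For vRound (Var vD)
    (pick_unscanned ;;
     If (Bin Lt (Var vU) (Var vD)) (scan ;; store_slot aDONE (Var vU) (Const 1)) Skip).

(** An edge from a scanned vertex to an inner vertex may later join two outer
    vertices of different classes, but then the second one is not scanned yet;
    hence classes are only compared between scanned vertices. *)
Definition search_inv d s :=
  [/\ search_forest d s,
      forall y, y < d -> scanned s y -> outer d s y,
      vars s vFound != 0 -> found_ends d s &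
      vars s vFound = 0 -> forall a b, edge d s a b -> scanned s a ->
        seen d s b /\ (scanned s b -> rep s a = rep s b)].

Section SearchLoop.

Variables (d : nat) (s : state).
Hypotheses (dE : vars s vD = d) (mm : matching d (edge d s) (mate s)).
Hypotheses (e_sym : symmetric (edge d s)).

Lemma searchP (Q : nat -> state -> Prop) :
  search_inv d s ->
  (forall t s', frame search s s' -> t <= 4000 * d.+1 ^ 2 ->
     search_inv d s' -> (forall y, outer d s' y -> scanned s' y) -> Q t s') ->
  wp search s Q.
Proof.
move=> inv0 IQ.
(* After k rounds at least k vertices are scanned, unless none is left to
   scan; so the d rounds suffice. *)
pose scans s1 := count (scanned s1) (iota 0 d).
pose I k t s1 := [/\ t + potential d s1 <= k * (500 * d.+1) + potential d s,
  search_inv d s1 & k <= scans s1 \/ forall y, outer d s1 y -> scanned s1 y].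
apply: (wp_for (N := d) (I := I)) => //.
- by split=> //; left.
- by move=> k t s1 _ [fv fa] _ _; rewrite /= fv.
- move=> k t s1 lt_kd [fv fa] xk [tle inv1 prog1].
  have edge1 : edge d s1 = edge d s by rewrite /edge fa.
  have mate1 : mate s1 = mate s by rewrite /mate fa.
  have d1 : vars s1 vD = d by rewrite fv.
  apply: wp_seq; apply: (pick_unscannedP d1) => t2 s2 [fv2 fa2] t2le pick.
  have d2 : vars s2 vD = d by rewrite fv2.
  have arrs2 : arrs s2 = arrs s1 by apply: functional_extensionality => a; rewrite fa2.
  have inv2 : search_inv d s2.
    move: inv1; rewrite /search_inv /search_forest /found_ends /edge /mate /seen /outer /rep
      /path_of /len /lab /scanned arrs2.
    by rewrite !(fv2 vFound) // !(fv2 vEndU) // !(fv2 vEndV).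
  have pot2 : potential d s2 = potential d s1 by rewrite /potential /nonouter /lab arrs2.
  have outer2 : outer d s2 = outer d s1 by rewrite /outer /lab arrs2.
  have scanned2 : scanned s2 = scanned s1 by rewrite /scanned arrs2.
  have edge2 : edge d s2 = edge d s by rewrite -edge1 /edge arrs2.
  have mate2 : mate s2 = mate s by rewrite -mate1 /mate arrs2.
  apply: (wp_if_bool (b := vars s2 vU < d)); first by rewrite /= d2.
    move=> ud; rewrite ud -scanned2 -outer2 in pick; have /andP[ou nsu] := pick.
    have [F2 sc2 fnd2 clo2] := inv2.
    apply: wp_seq; apply: (scanP F2 d2); rewrite ?edge2 ?mate2 //.
    move=> t3 s3 [fv3 fa3] t3le F3 ext3 fnd3 nf3 clo3; apply: wp_store => /=.
    have s3U : vars s3 vU = vars s2 vU by rewrite fv3.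
    have [seen3 outer3 rep3] := ext3.
    have edge3 : edge d s3 = edge d s by rewrite -edge2 /edge fa3.
    have mate3 : mate s3 = mate s by rewrite -mate2 /mate fa3.
    rewrite s3U; set u := vars s2 vU in ou nsu ud clo3 *.
    set s4 := set_cell _ _ _ _ _.
    have scanned4 y : scanned s4 y = (y == u) || scanned s2 y.
      rewrite /scanned /= fa3 //; by case: (y == u).
    split.
    + rewrite -[potential d (set_var _ _ _)]/(potential d s3) /= mulSn.
      by move: tle t2le t3le; rewrite pot2; lia.
    + split=> //.
      * move=> y yd; rewrite -[scanned _ y]/(scanned s4 y) scanned4.
        case/predU1P=> [->|/(sc2 y yd)]; [exact: outer3 | exact: outer3].
      * move=> nf a b; rewrite -[edge _ _]/(edge d s3) edge3.
        rewrite -![scanned (set_var _ _ _) _]/(scanned s4 _) !scanned4.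
        rewrite -[seen _ _]/(seen d s3) -[rep _]/(rep s3) => eab.
        have nfs2 := nf3 nf.
        have /and3P[ad bd _] := eab.
        have cl a' b' : a' = u -> b' < d -> edge d s a' b' ->
            seen d s3 b' /\ ((b' == u) || scanned s2 b' -> rep s3 a' = rep s3 b').
          move=> -> b'd eub'; have [sb rb] := clo3 nf b' eub'; split=> //.
          by case/predU1P=> [->//|/(sc2 b' b'd)/rb].
        case/predU1P=> [au|sa]; first exact: cl.
        rewrite edge2 in clo2; have [sb rb] := clo2 nfs2 a b eab sa.
        split; first exact: seen3.
        case/predU1P=> [bu|/rb]; last by apply: rep3 => //; apply: forest_seen F2 _ (sc2 _ ad sa).
        have [_ rba] := cl b a bu ad (etrans (e_sym b a) eab).
        by rewrite rba // sa orbT.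
    + left; case: prog1 => [le_k|all1]; last first.
        by rewrite scanned2 all1 // -outer2 in nsu.
      apply: leq_ltn_trans le_k _.
      rewrite /scans -!size_filter -[_.+1]/(size (u :: _)).
      apply: uniq_leq_size.
        by rewrite /= filter_uniq ?iota_uniq // mem_filter -scanned2 (negPf nsu).
      move=> y; rewrite inE !mem_filter -scanned2.
      rewrite -[scanned (set_var _ _ _) y]/(scanned s4 y) scanned4.
      by case/predU1P=> [->|/andP[-> ->]]; rewrite ?eqxx ?mem_vertices ?orbT.
  move=> nud; rewrite (negPf nud) in pick; apply: wp_skip; split=> //.
  + rewrite -[potential d (set_var _ _ _)]/(potential d s2) /= mulSn pot2.
    by move: tle t2le; lia.
  + right=> y; rewrite -[scanned _ y]/(scanned s2 y) scanned2.
    by rewrite -[outer _ _ y]/(outer d s2 y) outer2; apply: pick.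
- move=> t s1 fr _ [tle inv1 prog1]; apply: IQ => //.
    have : nonouter d s <= d by rewrite /nonouter -[leqRHS](size_iota 0) count_size.
    move=> /(leq_mul (leqnn (3000 * d))); move: tle; rewrite /potential /= -mulnn; lia.
  case: prog1 => // le_d y /andP[yd _].
  have /allP : all (scanned s1) (iota 0 d).
    by rewrite all_count eqn_leq count_size size_iota.
  by apply; rewrite mem_vertices.
Qed.

End SearchLoop.

Definition init_search : cmd :=
  Assign vFound (Const 0) ;;
  For vI (Var vD)
    (store_slot aDONE (Var vI) (Const 0) ;;
     If (Bin Eq (slot aMATE (Var vI)) (Var vI))
       (store_slot aLAB (Var vI) (Const 2) ;;
        store_slot aREP (Var vI) (Var vI) ;;
        Store aPATH (Var vI) (Const 0) (Var vI) ;;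
        store_slot aLEN (Var vI) (Const 1))
       (store_slot aLAB (Var vI) (Const 0))).

Lemma init_searchP d s (Q : nat -> state -> Prop) :
  vars s vD = d ->
  (forall t s', frame init_search s s' -> t <= 100 * d.+1 ->
     search_inv d s' -> Q t s') ->
  wp init_search s Q.
Proof.
move=> dE IQ.
suff: wp init_search s (fun t s' => t <= 100 * d.+1 /\ search_inv d s').
  by move=> H; apply: (wp_conseq H) => t s' fr [? ?]; apply: IQ.
apply: wp_seq; apply: wp_assign; rewrite /=; set s0 := set_var _ _ _.
pose I k s1 := forall y, y < k ->
  [/\ arrs s1 aDONE 0 y = 0, lab s1 y = (if mate s y == y then 2 else 0) &
      mate s y = y -> rep s1 y = y /\ path_of s1 y = [:: y]].
apply: (wp_for_const (N := d) (C := 50) (I := I)) => //.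
- by move=> k s1 _ [fv fa] _ _; rewrite /= fv.
- move=> k s1 lt_kd [fv fa] xk Ik; apply: wp_seq; apply: wp_store; rewrite /= xk.
  apply: (wp_if_bool (b := mate s k == k)); first by rewrite /= fa // xk.
    move=> mk; do 3![apply: wp_seq; apply: wp_store; rewrite /=]; apply: wp_store.
    rewrite /= xk; split=> // y; rewrite ltnS leq_eqVlt.
    rewrite /lab /rep /path_of /len /=.
    have [-> _|yk /= lt_yk] := eqVneq y k; first by rewrite (eqP mk) eqxx.
    exact: Ik.
  move=> mk; apply: wp_store; rewrite /= xk; split=> // y; rewrite ltnS leq_eqVlt.
  rewrite /lab /rep /path_of /len /=.
  have [-> _|yk /= lt_yk] := eqVneq y k; last exact: Ik.
  by rewrite (negPf mk); split=> // /eqP; rewrite (negPf mk).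
- move=> t s1 [fv fa] _ Id tle; split; first by rewrite /= in tle *; lia.
  have mateE : mate s1 = mate s by rewrite /mate fa.
  have seenE y : seen d s1 y = (y < d) && (mate s1 y == y).
    rewrite /seen mateE; case: ltnP => //= yd; have [_ -> _] := Id y yd.
    by case: ifP.
  have outerE : outer d s1 = seen d s1.
    apply: functional_extensionality => y; rewrite /seen /outer.
    by case: ltnP => //= yd; have [_ -> _] := Id y yd; case: ifP.
  split.
  + rewrite /search_forest outerE; apply: forest_init => // y.
    rewrite seenE mateE => /andP[yd /eqP my].
    by have [_ _ /(_ my)] := Id y yd.
  + by move=> y yd; rewrite /scanned; have [-> _ _] := Id y yd.
  + by rewrite fv.
  + move=> _ a b /and3P[ad _ _]; rewrite /scanned.
    by have [-> _ _] := Id a ad.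
Qed.

Definition flip_along (w : nat) : cmd :=
  Assign vJ (Const 0) ;;
  While (Bin Lt (Succ (Var vJ)) (slot aLEN (Var w)))
    (Store aMATE (Const 0) (Cell aPATH (Var w) (Var vJ))
       (Cell aPATH (Var w) (Succ (Var vJ))) ;;
     Store aMATE (Const 0) (Cell aPATH (Var w) (Succ (Var vJ)))
       (Cell aPATH (Var w) (Var vJ)) ;;
     Store aMATE (Const 0) (Cell aPATH (Var w) (Succ (Succ (Var vJ))))
       (Cell aPATH (Var w) (Succ (Succ (Var vJ)))) ;;
     Assign vJ (Succ (Succ (Var vJ)))).

Lemma flip_alongP w s (Q : nat -> state -> Prop) :
  w != vJ -> odd (len s (vars s w)) ->
  (forall t s', frame (flip_along w) s s' -> t <= 50 * (len s (vars s w)).+1 ->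
     mate s' = flip_path (mate s) (path_of s (vars s w)) -> Q t s') ->
  wp (flip_along w) s Q.
Proof.
move=> wJ odd_len IQ.
suff: wp (flip_along w) s (fun t s' => t <= 50 * (len s (vars s w)).+1 /\
   mate s' = flip_path (mate s) (path_of s (vars s w))).
  by move=> H; apply: (wp_conseq H) => t s' fr [? ?]; apply: IQ.
apply: wp_seq; apply: wp_assign; rewrite /=; set s0 := set_var _ _ _.
set p := path_of s (vars s w).
have sz_p : size p = len s (vars s w) by rewrite size_mkseq.
have nthp (s1 : state) : arrs s1 aPATH = arrs s aPATH ->
    vars s1 w = vars s w -> forall j, j < size p ->
    arrs s1 aPATH (vars s1 w) j = nth 0 p j.
  by move=> -> -> j; rewrite sz_p => jl; rewrite nth_mkseq.
suff loop q : forall x pre s1, p = pre ++ x :: q -> ~~ odd (size q) ->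
    vars s1 vJ = size pre -> vars s1 w = vars s w ->
    arrs s1 aPATH = arrs s aPATH -> arrs s1 aLEN = arrs s aLEN ->
    wp (While (Bin Lt (Succ (Var vJ)) (slot aLEN (Var w)))
    (Store aMATE (Const 0) (Cell aPATH (Var w) (Var vJ))
       (Cell aPATH (Var w) (Succ (Var vJ))) ;;
     Store aMATE (Const 0) (Cell aPATH (Var w) (Succ (Var vJ)))
       (Cell aPATH (Var w) (Var vJ)) ;;
     Store aMATE (Const 0) (Cell aPATH (Var w) (Succ (Succ (Var vJ))))
       (Cell aPATH (Var w) (Succ (Succ (Var vJ)))) ;;
     Assign vJ (Succ (Succ (Var vJ))))) s1
    (fun t s' => t <= 40 * (size q).+1 /\ mate s' = flip (mate s1) x q).
  have p_neq0 : 0 < size p by rewrite sz_p; case: (len s _) odd_len.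
  case pE: p p_neq0 => [//|x q] _.
  have oq : ~~ odd (size q) by move: odd_len; rewrite -sz_p pE.
  apply: (wp_conseq (loop q x [::] s0 pE oq _ _ _ _)) => //=.
    by rewrite (negPf wJ).
  by move=> t s' _ [tle mE]; rewrite -sz_p pE /=; split=> //; lia.
elim/pair_ind: q => [|//|y z q IHq] x pre s1 pE oq J1 w1 path1 len1.
  have szE : size p = (size pre).+1 by rewrite pE size_cat addn1.
  apply: wp_while_false; last by split.
  by rewrite /= J1 w1 len1 -/(len s _) -sz_p szE ltnn.
have szE : size p = size pre + (size q).+3 by rewrite pE size_cat.
have nth_pre j : nth 0 p (size pre + j) = nth 0 [:: x, y, z & q] j.
  by rewrite pE nth_cat ltnNge leq_addr addKn.
have nth0 : nth 0 p (size pre) = x by rewrite -[size pre]addn0 nth_pre.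
have nth1 : nth 0 p (size pre).+1 = y by rewrite -addn1 nth_pre.
have nth2 : nth 0 p (size pre).+2 = z by rewrite -addn2 nth_pre.
apply: wp_while_true.
  by rewrite /= J1 w1 len1 -/(len s _) -sz_p szE eqb0 negbK; lia.
have nthE j : j < size p -> arrs s1 aPATH (vars s1 w) j = nth 0 p j by apply: nthp.
have at0 : arrs s1 aPATH (vars s1 w) (size pre) = x by rewrite nthE ?nth0 //; lia.
have at1 : arrs s1 aPATH (vars s1 w) (size pre).+1 = y by rewrite nthE ?nth1 //; lia.
have at2 : arrs s1 aPATH (vars s1 w) (size pre).+2 = z by rewrite nthE ?nth2 //; lia.
do 3![apply: wp_seq; apply: wp_store; rewrite /= J1 ?at0 ?at1 ?at2].
apply: wp_assign; rewrite /= J1; set s2 := set_var _ _ _.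
apply: (wp_conseq (IHq z (pre ++ [:: x; y]) s2 _ _ _ _ _ _)) => //.
- by rewrite -catA.
- by move: oq => /=; rewrite negbK.
- by rewrite /= size_cat addn2.
- by rewrite /= (negPf wJ).
move=> t s' _ [tle mE]; split; last exact: mE.
by rewrite /=; lia.
Qed.

Definition augment_mate : cmd :=
  If (Var vFound)
    (flip_along vEndU ;; flip_along vEndV ;;
     store_slot aMATE (Var vEndU) (Var vEndV) ;;
     store_slot aMATE (Var vEndV) (Var vEndU))
    Skip.

Definition phase : cmd := init_search ;; search ;; augment_mate.

Lemma even_path_odd d e m v p : even_path d e m v p -> odd (size p).
Proof.
move=> [x [q [-> _ xq _ _]]] /=.
by elim/pair_ind: q x xq => [|//|y z q IHq] x //= /and3P[_ _ /IHq]; rewrite negbK.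
Qed.

Lemma phaseP d s (Q : nat -> state -> Prop) :
  vars s vD = d -> matching d (edge d s) (mate s) -> symmetric (edge d s) ->
  (forall t s', frame phase s s' -> t <= 4500 * d.+1 ^ 2 ->
     matching d (edge d s) (mate s') ->
     (forall w, w < d -> mate s w != w -> mate s' w != w) ->
     size (exposed d (mate s')) < size (exposed d (mate s)) \/
       maximum_matching d (edge d s) (mate s') -> Q t s') ->
  wp phase s Q.
Proof.
move=> dE mm e_sym IQ.
suff: wp phase s (fun t s' => [/\ t <= 4500 * d.+1 ^ 2,
     matching d (edge d s) (mate s'),
     (forall w, w < d -> mate s w != w -> mate s' w != w) &
     size (exposed d (mate s')) < size (exposed d (mate s)) \/
       maximum_matching d (edge d s) (mate s')]).
  by move=> H; apply: (wp_conseq H) => t s' fr [? ? ? ?]; apply: IQ.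
apply: wp_seq; apply: (init_searchP dE) => t1 s1 [fv1 fa1] t1le inv1.
have edge1 : edge d s1 = edge d s by rewrite /edge fa1.
have mate1 : mate s1 = mate s by rewrite /mate fa1.
have d1 : vars s1 vD = d by rewrite fv1.
apply: wp_seq; apply: (searchP d1 _ _ inv1); rewrite ?edge1 ?mate1 //.
move=> t2 s2 [fv2 fa2] t2le [F2 _ fnd2 clo2] all2.
have edge2 : edge d s2 = edge d s by rewrite -edge1 /edge fa2.
have mate2 : mate s2 = mate s by rewrite -mate1 /mate fa2.
have dd : d.+1 <= d.+1 ^ 2 by rewrite -mulnn leq_pmulr.
apply: wp_if => fnd; last first.
  apply: wp_skip; rewrite mate2; split=> [|//|//|].
    by move: t1le t2le dd => /=; move: (_ ^ 2) => D; clear; lia.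
  right; rewrite -mate2 -edge2; apply: (forest_maximum _ F2).
    by rewrite edge2 mate2.
  move=> u v ou vd euv; have [sv rv] := clo2 fnd u v euv (all2 u ou).
  by split=> // /all2.
have {fnd2} [ou ov euv roots] := fnd2 fnd.
rewrite -/(vars s2 vEndU) in ou euv roots.
set u := vars s2 vEndU in ou euv roots; set v := vars s2 vEndV in ov euv roots.
have pu := forest_path F2 ou; have pv := forest_path F2 ov.
have lenE w : len s2 w = size (path_of s2 w) by rewrite size_mkseq.
apply: wp_seq; apply: flip_alongP; rewrite // ?lenE; first exact: even_path_odd pu.
move=> t3 s3 [fv3 fa3] t3le mate3.
have v3 : vars s3 vEndV = v by rewrite fv3.
have u3 : vars s3 vEndU = u by rewrite fv3.
have len3 : len s3 = len s2 by rewrite /len fa3.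
have path3 : path_of s3 = path_of s2 by rewrite /path_of len3 fa3.
apply: wp_seq; apply: flip_alongP; rewrite // ?v3 ?len3 ?lenE; first exact: even_path_odd pv.
move=> t4 s4 [fv4 fa4] t4le mate4.
have v4 : vars s4 vEndV = v by rewrite fv4.
have u4 : vars s4 vEndU = u by rewrite fv4.
apply: wp_seq; apply: wp_store; apply: wp_store.
set s5 := set_cell (set_cell _ _ _ _ _) _ _ _ _.
have mate5 : mate s5 = augment (mate s) u v (path_of s2 u) (path_of s2 v).
  have -> : mate s5 = upd (upd (mate s4) (vars s4 vEndU) (vars s4 vEndV))
                          (vars s4 vEndV) (vars s4 vEndU) by [].
  rewrite u4 v4.
  by rewrite /augment -mate2 -mate3 -path3 -mate4.
rewrite mate2 edge2 in pu pv.
have disj := distinct_roots_disjoint F2 ou ov roots.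
rewrite edge2 in euv.
have [mm5 cov5 lt5] := augmentP e_sym mm pu pv disj euv.
have /andP[_ lu] := path_size F2 ou; have /andP[_ lv] := path_size F2 ov.
rewrite mate5; split=> [|//|//|]; last by left.
move: t1le t2le dd t3le t4le lu lv; rewrite -/u -/v /=.
by move: (_ ^ 2) => D; clear; lia.
Qed.

Definition max_match : cmd := For vPhase (Var vD) phase.

(** Every phase that is not final covers a new vertex, so [d] phases suffice. *)
Lemma max_matchP d s (Q : nat -> state -> Prop) :
  vars s vD = d -> matching d (edge d s) (mate s) -> symmetric (edge d s) ->
  (forall t s', frame max_match s s' -> t <= 5000 * d.+1 ^ 3 ->
     maximum_matching d (edge d s) (mate s') ->
     (forall w, w < d -> mate s w != w -> mate s' w != w) -> Q t s') ->
  wp max_match s Q.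
Proof.
move=> dE mm e_sym IQ.
pose I k s1 := [/\ matching d (edge d s) (mate s1),
  (forall w, w < d -> mate s w != w -> mate s1 w != w) &
  size (exposed d (mate s1)) + k <= d \/ maximum_matching d (edge d s) (mate s1)].
apply: (wp_for_const (N := d) (C := 4500 * d.+1 ^ 2) (I := I)) => //.
- split=> //; left; rewrite addn0 size_filter -[leqRHS](size_iota 0).
  exact: count_size.
- by move=> k s1 _ [fv fa] _ _; rewrite /= fv.
- move=> k s1 lt_kd [fv fa] xk [mm1 cov1 prog1].
  have edge1 : edge d s1 = edge d s by rewrite /edge fa.
  apply: (@phaseP d); rewrite ?edge1 // ?fv // => t2 s2 fr2 t2le mm2 cov2 prog2.
  split=> //; split=> //; first by move=> w wd /(cov1 w wd)/(cov2 w wd).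
  rewrite -[mate (set_var _ _ _)]/(mate s2).
  case: prog2 => [lt2|]; last by right.
  case: prog1 => [le1|[_ max1]]; first by left; rewrite addnS; lia.
  by have := max1 _ mm2; rewrite leqNgt lt2.
- move=> t s1 fr _ [mm1 cov1 prog1] tle; apply: IQ => //.
    have : d.+1 ^ 3 = d.+1 * d.+1 ^ 2 by rewrite expnS.
    have : d.+1 <= d.+1 ^ 2 by rewrite -mulnn leq_pmulr.
    by move: tle => /=; move: (d.+1 ^ 3) (d.+1 ^ 2) => a b; nia.
  case: prog1 => // le0; split=> // m' _.
  suff -> : size (exposed d (mate s1)) = 0 by [].
  by lia.
Qed.

(** * The complete program *)

Definition fill (a : nat) (e : expr) : cmd :=
  For vI (Var vD) (For vJ (Var vD) (Store a (Var vI) (Var vJ) e)).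

Lemma fillP d a e (f : nat -> nat -> nat) s (Q : nat -> state -> Prop) :
  vars s vD = d ->
  (forall s1, (forall b, b != a -> arrs s1 b = arrs s b) ->
     eval_expr s1 e = f (vars s1 vI) (vars s1 vJ)) ->
  (forall t s', frame (fill a e) s s' -> t <= (expr_cost e + 30) * d.+1 ^ 2 ->
     (forall i j, i < d -> j < d -> arrs s' a i j = f i j) -> Q t s') ->
  wp (fill a e) s Q.
Proof.
move=> dE eE IQ.
pose I k s1 := forall i j, i < k -> j < d -> arrs s1 a i j = f i j.
apply: (wp_for_const (N := d) (C := (expr_cost e + 10) * d + 6) (I := I)) => //.
- by move=> k s1 _ [fv fa] _ _; rewrite /= fv.
- move=> i s1 lt_id [fv1 fa1] xi Ii.
  pose J k s2 := I i s2 /\ forall j, j < k -> arrs s2 a i j = f i j.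
  apply: (wp_for_const (N := d) (C := expr_cost e + 3) (I := J)) => //.
  + by move=> k s2 _ [fv fa] _ _; rewrite /= fv //= fv1.
  + move=> j s2 lt_jd [fv2 fa2] xj [Is2 Js2]; apply: wp_store => /=.
    have s2I : vars s2 vI = i by rewrite fv2.
    split; first by lia.
    have valE : eval_expr s2 e = f i j.
      rewrite eE ?s2I ?xj // => b ba.
      by rewrite fa2 ?fa1 //= inE (negPf ba).
    rewrite valE s2I xj; split=> [i' j' lt_i' lt_j'|j' lt_j'] /=; rewrite eqxx /=.
      by rewrite ltn_eqF //= Is2.
    by rewrite eqxx /=; case: (ltngtP j' j) lt_j' => [lt_j' _|//|-> //]; [exact: Js2|lia].
  + move=> t s2 [fv2 fa2] _ [Is2 Js2] tle; split; first by move: tle => /=; lia.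
    move=> i' j' /=; rewrite ltnS leq_eqVlt => /predU1P[-> /Js2|] //.
    exact: Is2.
- move=> t s1 fr _ Id tle; apply: IQ => //.
  by apply: leq_trans tle _; rewrite /= -mulnn; nia.
Qed.

Section Main.

Variables (d : nat) (s : state).

Let inF i := arrs s aF 0 i != 0.
Let A i j := arrs s aIN i j != 0.

(** An arc points from a state that is kept to one that may be removed. When
    two states of [F] could each be read off from the other, only the arc to the
    larger one is retained, so that every edge has a single orientation. *)
Definition arc i j :=
  [&& inF i, A i j, i != j & ~~ [&& inF j, A j i & ~~ (i < j)]].

Definition graph : rel nat := fun i j => [&& i < d, j < d & arc i j || arc j i].

(** If [F] is feasible, the maximum matchings of this bipartite graph cover the
    complement of [F]. *)
Definition cut_graph : rel nat := fun i j => graph i j && (inF i != inF j).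

End Main.

Definition arc_expr : expr :=
  eAnd (slot aF (Var vI)) (eAnd (Cell aIN (Var vI) (Var vJ))
  (eAnd (eNot (Bin Eq (Var vI) (Var vJ)))
  (eNot (eAnd (slot aF (Var vJ)) (eAnd (Cell aIN (Var vJ) (Var vI))
    (eNot (Bin Lt (Var vI) (Var vJ)))))))).

Definition graph_expr : expr :=
  eNot (eAnd (eNot (Cell aARC (Var vI) (Var vJ))) (eNot (Cell aARC (Var vJ) (Var vI)))).

Definition cut_expr : expr :=
  eAnd graph_expr (eNot (Bin Eq (eNot (slot aF (Var vI))) (eNot (slot aF (Var vJ))))).

Definition program : cmd :=
  fill aARC arc_expr ;;
  fill aADJ cut_expr ;;
  For vI (Var vD) (store_slot aMATE (Var vI) (Var vI)) ;;
  max_match ;;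
  fill aADJ graph_expr ;;
  max_match ;;
  For vI (Var vD)
    (store_slot aOUT (Var vI) (eNot (Cell aARC (slot aMATE (Var vI)) (Var vI)))).

Lemma programP d s : vars s vD = d ->
  exists t s' m1 m2,
    [/\ exec program s t s', t <= 1000 * (50 * d.+1 ^ 3),
        maximum_matching d (cut_graph d s) m1,
        maximum_matching d (graph d s) m2 &
        (forall w, w < d -> m1 w != w -> m2 w != w) /\
        (forall v, v < d -> (arrs s' aOUT 0 v != 0) = ~~ arc s (m2 v) v)].
Proof.
move=> dE.
suff [t [s' [ex [m1 [m2 [? ? ? [? ?]]]]]]] : wp program s (fun t s' => exists m1 m2,
  [/\ t <= 1000 * (50 * d.+1 ^ 3), maximum_matching d (cut_graph d s) m1,
        maximum_matching d (graph d s) m2 &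
        (forall w, w < d -> m1 w != w -> m2 w != w) /\
        (forall v, v < d -> (arrs s' aOUT 0 v != 0) = ~~ arc s (m2 v) v)]).
  by exists t, s', m1, m2.
apply: wp_seq; apply: (fillP (f := fun i j => arc s i j) dE).
  move=> s1 E; rewrite /arc_expr !(eval_eAnd, eval_eNot).
  by rewrite /arc /= !E // !eqb0 !negbK.
move=> t1 s1 [fv1 fa1] t1le arc1.
have d1 : vars s1 vD = d by rewrite fv1.
apply: wp_seq; apply: (fillP (f := fun i j =>
  ((arrs s1 aARC i j != 0) || (arrs s1 aARC j i != 0)) &&
  ((arrs s1 aF 0 i != 0) != (arrs s1 aF 0 j != 0))) d1).
  move=> s2 E; rewrite /cut_expr /graph_expr !(eval_eAnd, eval_eNot) /= !E //.
  by do 4!case: (arrs s1 _ _ _ == 0).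
move=> t2 s2 [fv2 fa2] t2le adj2.
have d2 : vars s2 vD = d by rewrite fv2.
apply: wp_seq; apply: (wp_for_const (N := d) (C := 5)
   (I := fun k s' => forall v, v < k -> mate s' v = v)) => //.
- by move=> k s3 _ [fv fa] _ _; rewrite /= fv.
- move=> k s3 lt_kd [fv fa] xk Ik; apply: wp_store; rewrite /= xk; split=> // v.
  by rewrite ltnS leq_eqVlt /mate /=; case: eqP => //= _ /Ik.
move=> t3 s3 [fv3 fa3] _ mate3 t3le.
have d3 : vars s3 vD = d by rewrite fv3.
have edge3 : edge d s3 = cut_graph d s.
  apply: functional_extensionality => i; apply: functional_extensionality => j.
  rewrite /edge /cut_graph /graph; case: ltnP => //= id; case: ltnP => //= jd.
  by rewrite fa3 // adj2 // !arc1 // !fa1 // !eqb0 !negbK.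
have arc_irr i : arc s i i = false by rewrite /arc eqxx !andbF.
have cut_sym : symmetric (cut_graph d s).
  move=> i j; rewrite /cut_graph /graph andbCA [arc s i j || _]orbC.
  by rewrite (eq_sym (_ != 0)).
have graph_sym : symmetric (graph d s).
  by move=> i j; rewrite /graph andbCA [arc s i j || _]orbC.
have mm3 : matching d (cut_graph d s) (mate s3).
  by move=> v vd; rewrite !mate3 // eqxx.
apply: wp_seq; apply: (max_matchP d3); rewrite ?edge3 // => t4 s4 [fv4 fa4] t4le max4 _.
have d4 : vars s4 vD = d by rewrite fv4.
apply: wp_seq; apply: (fillP (f := fun i j =>
  (arrs s4 aARC i j != 0) || (arrs s4 aARC j i != 0)) d4).
  move=> s' E; rewrite /graph_expr !(eval_eAnd, eval_eNot) /= !E //.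
  by do 2!case: (arrs s4 _ _ _ == 0).
move=> t5 s5 [fv5 fa5] t5le adj5.
have d5 : vars s5 vD = d by rewrite fv5.
have arc4 i j : i < d -> j < d -> arrs s4 aARC i j = arc s i j.
  by move=> id jd; rewrite fa4 // fa3 // fa2 // arc1.
have edge5 : edge d s5 = graph d s.
  apply: functional_extensionality => i; apply: functional_extensionality => j.
  rewrite /edge /graph; case: ltnP => //= id; case: ltnP => //= jd.
  by rewrite adj5 // !arc4 // !eqb0 !negbK.
have mate5 : mate s5 = mate s4 by rewrite /mate fa5.
have mm5 : matching d (graph d s) (mate s5).
  move=> v vd; rewrite mate5; have [mm4 _] := max4; have [md mmv ev] := mm4 v vd.
  by split=> // /ev /andP[].
apply: wp_seq; apply: (max_matchP d5); rewrite ?edge5 // => t6 s6 [fv6 fa6] t6le max6 cov6.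
have arc6 i j : i < d -> j < d -> arrs s6 aARC i j = arc s i j.
  by move=> id jd; rewrite fa6 // fa5 // arc4.
apply: (wp_for_const (N := d) (C := 20)
   (I := fun k s' => forall v, v < k -> (arrs s' aOUT 0 v != 0) = ~~ arc s (mate s6 v) v)) => //.
- by move=> k s7 _ [fv fa] _ _; rewrite /= fv // fv6.
- move=> k s7 lt_kd [fv fa] xk Ik; apply: wp_store; rewrite /= xk; split=> // v.
  have [[mm6 _] kd] := (max6, lt_kd); have [md _ _] := mm6 k lt_kd.
  rewrite (fa aARC) // (fa aMATE) // -/(mate s6 k) arc6 // ltnS leq_eqVlt.
  by case: eqP => [-> _|_ /= /Ik //]; rewrite !eqb0 negbK.
move=> t7 s7 [fv7 fa7] _ out7 t7le.
exists (mate s4), (mate s6); split=> [|//|//|]; last by rewrite -mate5; split.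
have dd : d.+1 <= d.+1 ^ 2 by rewrite -mulnn leq_pmulr.
have ddd : d.+1 ^ 2 <= d.+1 ^ 3 by rewrite leq_pexp2l.
move: t1le t2le t3le t4le t5le t6le t7le dd ddd.
rewrite [expr_cost arc_expr]/= [expr_cost cut_expr]/= [expr_cost graph_expr]/=.
rewrite [expr_cost (Var _)]/=.
by move: (d.+1 ^ 2) (d.+1 ^ 3) => D E; clear; lia.
Qed.

Import Order.TTheory GRing.Theory Num.Theory.
Local Open Scope ring_scope.

(** * Structural observability within two steps *)

(** Every state outside [J] appears in the second step in the row of a state of
    [J] of its own. *)
Definition assigned d (A : sparsity d d) (J : {set 'I_d}) (f : 'I_d -> 'I_d) :=
  (forall v, v \notin J -> f v \in J /\ A (f v) v) /\
  (forall v w, v \notin J -> w \notin J -> f v = f w -> v = w).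

Section Observability.

Variables (R : realType) (d : nat) (A : sparsity d d) (J : {set 'I_d}).

Lemma obs_mxE p k (A1 : 'M[R]_d) (C1 : 'M[R]_(p, d)) s j :
  obs_mx k A1 C1 s j = (C1 *m A1 ^+ tagnat.sig1 s) (tagnat.sig2 s) j.
Proof. by rewrite /obs_mx !mxE. Qed.

Lemma obs_mx_row p k (A1 : 'M[R]_d) (C1 : 'M[R]_(p, d)) (i : 'I_k) (j : 'I_p) :
  (row j (C1 *m A1 ^+ i) <= obs_mx k A1 C1)%MS.
Proof.
suff -> : row j (C1 *m A1 ^+ i) = row (@tagnat.Rank k (fun=> p) i j) (obs_mx k A1 C1).
  exact: row_sub.
have /matrixP/(_ j) E := @mxcolK R k (fun=> p) d (fun i => C1 *m A1 ^+ i) i.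
by apply/rowP => l; rewrite [RHS]mxE [LHS]mxE -E [LHS]mxE.
Qed.

Lemma sparsity_rowsP (C1 : 'M[R]_(#|J|, d)) i j :
  realizations (sparsity_rows J) C1 -> C1 i j != 0 -> enum_val i = j.
Proof.
move=> C1J; apply: contraNeq => ij; apply/eqP/C1J.
by rewrite /sparsity_rows /sparsity_id !mxE.
Qed.

(** A nonsingular choice of [d] rows has a nonzero term in its determinant: each
    state gets a row of its own with a nonzero entry. A state outside [J] can
    only get a row of the second step. *)
Lemma full_obs_assigned k (A1 : 'M[R]_d) (C1 : 'M[R]_(#|J|, d)) :
  realizations A A1 -> realizations (sparsity_rows J) C1 -> (k <= 2)%N ->
  \rank (obs_mx k A1 C1) = d -> exists f, assigned A J f.
Proof.
move=> A1A C1J le_k2 rk.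
have full : row_full (obs_mx k A1 C1) by rewrite /row_full rk.
have := fullrowsub_unit full; rewrite unitmxE unitfE /determinant.
(* A nonzero term of the determinant matches the states with distinct rows. *)
have [/existsP[s /forallP s_neq0] _|] := boolP [exists s : 'S_d,
    [forall i, rowsub (fullrankfun full) (obs_mx k A1 C1) i (s i) != 0]]; last first.
  rewrite negb_exists => /forallP no_s; case/negP; apply/eqP.
  rewrite big1 // => s _; have /forallPn[i] := no_s s; rewrite negbK => /eqP s0.
  by rewrite (bigD1 i) //= s0 mul0r mulr0.
pose rho v := fullrankfun full ((s^-1)%g v).
have rho_inj : injective rho.
  by move=> v w /fullrankfun_inj/perm_inj.
have rho_neq0 v : obs_mx k A1 C1 (rho v) v != 0.
  by have := s_neq0 ((s^-1)%g v); rewrite mxE permKV.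
have rho1 v : v \notin J ->
    tagnat.sig1 (rho v) = 1%N :> nat /\ A (enum_val (tagnat.sig2 (rho v))) v.
  move=> vJ; have := rho_neq0 v; rewrite obs_mxE.
  have [/eqP ->|i_neq0] := boolP (tagnat.sig1 (rho v) == 0 :> nat).
    rewrite expr0 mulmx1 => /(sparsity_rowsP C1J) jv.
    by rewrite -jv enum_valP in vJ.
  have i1 : tagnat.sig1 (rho v) = 1%N :> nat.
    apply/eqP; rewrite eqn_leq lt0n i_neq0 andbT -ltnS.
    exact: leq_trans (ltn_ord _) le_k2.
  rewrite i1 expr1 mxE => sum_neq0; split=> //.
  have [l] : exists l, C1 (tagnat.sig2 (rho v)) l * A1 l v != 0.
    apply/existsP; apply: contraNT sum_neq0; rewrite negb_exists => /forallP all0.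
    by rewrite big1 // => l _; apply/eqP; rewrite -[_ == _]negbK all0.
  rewrite mulf_eq0 negb_or => /andP[/(sparsity_rowsP C1J) -> Alv].
  by apply: contraNT Alv => nA; apply/eqP/A1A.
exists (fun v => enum_val (tagnat.sig2 (rho v))); split=> [v vJ|v w vJ wJ].
  by rewrite enum_valP; have [_ ->] := rho1 v vJ.
move=> /enum_val_inj vw; apply: rho_inj; apply: tagnat.sig_inj.
have [v1 _] := rho1 v vJ; have [w1 _] := rho1 w wJ.
move: vw; rewrite /tagnat.sig2 /tagnat.sig1 in v1 w1 *.
case: (tagnat.sig (rho v)) (tagnat.sig (rho w)) v1 w1 => [i a] [j b] /= i1 j1 ->.
by have -> : i = j by apply: val_inj; rewrite /= i1 j1.
Qed.

(** With the entries [A (f v) v] equal to 1 and all others equal to 0, the rows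
    of the two steps are the unit rows. *)
Lemma assigned_full_obs f : assigned A J f ->
  exists (A1 : 'M[R]_d) (C1 : 'M[R]_(#|J|, d)),
    [/\ realizations A A1, realizations (sparsity_rows J) C1 &
        \rank (obs_mx 2 A1 C1) = d].
Proof.
move=> [fJ f_inj].
pose A1 : 'M[R]_d := \matrix_(i, j) ((j \notin J) && (i == f j))%:R.
pose C1 : 'M[R]_(#|J|, d) := \matrix_(i, j) (enum_val i == j)%:R.
have rowC1 i : row i C1 = delta_mx 0 (enum_val i).
  by apply/rowP => j; rewrite !mxE eqxx eq_sym.
exists A1, C1; split.
- move=> i j nA; rewrite mxE; case: (boolP (j \in J)) => //= jJ.
  by case: eqP nA => // ->; have [_ ->] := fJ j jJ.
- by move=> i j; rewrite /sparsity_rows /sparsity_id !mxE => /negPf ->.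
apply/eqP; rewrite -[_ == _]/(row_full _) -sub1mx; apply/row_subP => v.
rewrite row1; have [vJ|vJ] := boolP (v \in J).
  have := obs_mx_row A1 C1 (0 : 'I_2) (enum_rank_in vJ v).
  by rewrite expr0 mulmx1 rowC1 enum_rankK_in.
have [fvJ _] := fJ v vJ.
have := obs_mx_row A1 C1 (1 : 'I_2) (enum_rank_in fvJ (f v)).
rewrite expr1 row_mul rowC1 enum_rankK_in // -rowE.
suff -> : row (f v) A1 = delta_mx 0 v by [].
apply/rowP => w; rewrite !mxE eqxx /=; congr (_%:R); congr nat_of_bool.
apply/andP/eqP => [[wJ /eqP fvw]|->]; last by rewrite vJ eqxx.
by apply: f_inj.
Qed.

Lemma obs_index_le2 : (2 <= d)%N ->
  (obs_index R A (sparsity_rows J) <= 2%:E)%E <-> exists f, assigned A J f.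
Proof.
move=> d_ge2; split; last first.
  move=> [f /assigned_full_obs[A1 [C1 [A1A C1J rk]]]].
  apply: ereal_inf_lbound; exists 2%N => //; split=> //.
  apply/eqP; rewrite eq_le; apply/andP; split.
    apply: ge_ereal_sup => _ [A2 _ [C2 _ <-]].
    by rewrite lee_fin ler_nat rank_leq_col.
  by apply: ereal_sup_ubound; exists A1 => //; exists C1 => //; rewrite rk.
apply: contraPP => no_f; apply/negP; rewrite -ltNge.
apply: (@lt_le_trans _ _ (3%:R%:E : \bar R)); first by rewrite lte_fin ltr_nat.
apply: le_ereal_inf_tmp => _ [k [/andP[k_gt0 _] sup_d] <-].
rewrite lee_fin ler_nat ltnNge; apply/negP => le_k2.
suff: (d%:R%:E <= d.-1%:R%:E :> \bar R)%E.
  by rewrite lee_fin ler_nat leqNgt prednK ?leqnn // (leq_trans _ d_ge2).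
rewrite -[X in (X <= _)%E]sup_d; apply: ge_ereal_sup => _ [A1 A1A [C1 C1J <-]].
have d_gt0 : (0 < d)%N by apply: leq_trans d_ge2.
rewrite lee_fin ler_nat -ltnS (prednK d_gt0) ltn_neqAle rank_leq_col andbT.
apply/eqP => rk.
by apply: no_f; apply: full_obs_assigned rk.
Qed.

End Observability.

(** * Optimal sets and maximum matchings *)

(** The involution exchanges [h] with the other covered vertices. *)
Lemma heads_count d e m (h : pred nat) :
  matching d e m ->
  (forall v, (v < d)%N -> m v != v -> h (m v) = ~~ h v) ->
  (forall v, (v < d)%N -> h v -> m v != v) ->
  (size (exposed d m) + 2 * count h (iota 0 d) = d)%N.
Proof.
move=> mm hm hfix.
have m_inj : {in gtn d &, injective m}.
  by move=> v w vd wd vw; have [_ <- _] := mm v vd; rewrite vw; have [_ -> _] := mm w wd.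
have mates (p q : pred nat) : (forall v, (v < d)%N -> p v -> q (m v)) ->
    (count p (iota 0 d) <= count q (iota 0 d))%N.
  move=> pq; rewrite -!size_filter -(size_map m); apply: uniq_leq_size.
    rewrite map_inj_in_uniq ?filter_uniq ?iota_uniq // => v w.
    rewrite !mem_filter !mem_vertices => /andP[_ vd] /andP[_ wd].
    exact: m_inj.
  move=> _ /mapP[v + ->]; rewrite !mem_filter !mem_vertices => /andP[pv vd].
  by have [-> _ _] := mm v vd; rewrite pq.
have swap : count h (iota 0 d) = count (fun v => (m v != v) && ~~ h v) (iota 0 d).
  apply/eqP; rewrite eqn_leq !mates // => v vd; have [_ mmv _] := mm v vd.
    by move=> /andP[mv]; rewrite hm.
  by move=> hv; have mv := hfix v vd hv; rewrite hm // hv mmv eq_sym mv.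
have part r : {subset r <= iota 0 d} ->
    (count (fun v => m v == v) r + count h r +
     count (fun v => (m v != v) && ~~ h v) r = size r)%N.
  elim: r => //= v r IHr sub.
  have vd : (v < d)%N by rewrite -mem_vertices sub ?mem_head.
  have {}IHr := IHr (fun w wr => sub w (mem_behead (s := v :: r) wr)).
  by have := hfix v vd; case: (m v == v) (h v) => [] [] //= ; first (move/(_ isT)); lia.
by rewrite mul2n -addnn {2}swap size_filter addnA part // size_iota.
Qed.

Lemma count_card d (h : pred nat) : count h (iota 0 d) = #|[set v : 'I_d | h v]%SET|.
Proof.
rewrite -val_enum_ord count_map -sum1_count big_enum_cond -sum1_card.
by apply: eq_bigl => v; rewrite !inE.
Qed.

Section Reduction.

Variables (d : nat) (A : sparsity d d) (F : {set 'I_d}).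
Let s := input_state A F.

Lemma input_F (v : 'I_d) : (arrs s aF 0 v != 0%N) = (v \in F).
Proof. by rewrite /s /= valK; case: (v \in F). Qed.

Lemma input_A (u v : 'I_d) : (arrs s aIN u v != 0%N) = A u v.
Proof. by rewrite /s /= !valK; case: (A u v). Qed.

Lemma arcE (u v : 'I_d) :
  arc s u v = [&& u \in F, A u v, u != v & ~~ [&& v \in F, A v u & ~~ (u < v)%N]].
Proof. by rewrite /arc !input_F !input_A. Qed.

Lemma arc_irrefl (v : nat) : arc s v v = false.
Proof. by rewrite /arc eqxx !andbF. Qed.

Lemma arc_asym (u v : nat) : arc s u v -> ~~ arc s v u.
Proof.
rewrite /arc => /and4P[uF Auv uv]; apply: contra => /and4P[vF Avu _].
rewrite uF Auv vF Avu /= negbK; lia.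
Qed.

Lemma graph_arc (u v : 'I_d) : u \in F -> A u v -> u != v -> graph d s u v.
Proof.
move=> uF Auv uv; rewrite /graph !ltn_ord !arcE uF Auv uv (eq_sym v) uv /=.
case: (v \in F) => //=; case: (A v u) => //=; rewrite !negbK.
by move: uv; rewrite -val_eqE /=; case: ltngtP.
Qed.

Lemma graph_sym : symmetric (graph d s).
Proof. by move=> u v; rewrite /graph andbCA [arc s u v || _]orbC. Qed.

(** The matching that pairs each state outside [J] with the one it is read off
    from. *)
Lemma assigned_matching (J : {set 'I_d}) f : J \subset F -> assigned A J f ->
  exists m, [/\ matching d (graph d s) m,
    (size (exposed d m) + 2 * #|~: J| = d)%N &
    J = F -> matching d (cut_graph d s) m].
Proof.
move=> /fintype.subsetP JF [fJ f_inj].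
(* The mate of a state of J is the state that it is assigned to, if any. *)
pose mo v := if v \notin J then f v else
  if [pick w | (w \notin J) && (f w == v)] is Some w then w else v.
pose m n := if insub n is Some v then val (mo v : 'I_d) else n.
have mE (v : 'I_d) : m v = mo v by rewrite /m valK.
have mo_tail v : v \notin J -> mo v = f v by rewrite /mo => ->.
have mo_head v : v \notin J -> mo (f v) = v.
  move=> vJ; have [fvJ _] := fJ v vJ; rewrite /mo fvJ /=.
  case: pickP => [w /andP[wJ /eqP/f_inj->//]|/(_ v)].
  by rewrite vJ eqxx.
have moP v : [\/ v \notin J, exists2 w, w \notin J & f w = v | v \in J /\ mo v = v].
  have [vJ|vJ] := boolP (v \in J); last by constructor 1.
  rewrite /mo vJ /=; case: pickP => [w /andP[wJ /eqP fw]|_]; last by constructor 3.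
  by constructor 2; exists w.
have edge_f v : v \notin J -> graph d s (f v) v.
  move=> vJ; have [fvJ Afv] := fJ v vJ; apply: graph_arc => //; first exact: JF.
  by apply: contraNneq vJ => <-.
have momo v : mo (mo v) = v.
  have [vJ|[w wJ <-]|[_ mv]] := moP v; last by rewrite !mv.
    by rewrite (mo_tail v) // mo_head.
  by rewrite mo_head // mo_tail.
have edge_mo v : mo v != v -> graph d s v (mo v).
  have [vJ _|[w wJ <-] _|[_ ->]] := moP v; last by rewrite eqxx.
    by rewrite mo_tail // graph_sym edge_f.
  by rewrite mo_head // edge_f.
have out v : v \notin J -> (mo v \notin J) = false.
  by move=> vJ; rewrite mo_tail //; have [->] := fJ v vJ.
have flipJ v : mo v != v -> (mo v \notin J) = ~~ (v \notin J).
  have [vJ _|[w wJ <-] _|[_ ->]] := moP v; last by rewrite eqxx.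
    by rewrite out // vJ.
  by rewrite mo_head // wJ; have [->] := fJ w wJ.
have mm : matching d (graph d s) m.
  move=> v vd; rewrite -[v]/(val (Ordinal vd)) mE; split; first exact: ltn_ord.
    by rewrite mE momo.
  exact: edge_mo.
exists m; split=> //.
  pose h n := if insub n is Some v then (v : 'I_d) \notin J else false.
  have hE (v : 'I_d) : h v = (v \notin J) by rewrite /h valK.
  have -> : #|~: J| = count h (iota 0 d).
    by rewrite count_card; apply: eq_card => v; rewrite !inE hE.
  apply: (heads_count mm) => v vd; rewrite -[v]/(val (Ordinal vd)) mE !hE.
    exact: flipJ.
  move=> vJ; apply/eqP => /val_inj mv.
  by have := out _ vJ; rewrite mv vJ.
move=> JFE v vd; have [md mmv ev] := mm v vd; split=> // mv; rewrite /cut_graph ev //=.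
move: mv; rewrite -[v]/(val (Ordinal vd)) mE => mv.
rewrite !input_F -JFE; have := flipJ (Ordinal vd) mv.
by case: (_ \in J) (_ \in J) => [] [].
Qed.

(** In the bipartite graph, covering the complement of [F] is a matter of
    cardinality. *)
Lemma cut_maximum_covers f m : assigned A F f ->
  maximum_matching d (cut_graph d s) m ->
  forall v : 'I_d, v \notin F -> m v != v.
Proof.
move=> Ff [mm m_max].
have [m' [_ size_m' /(_ erefl) mm']] := assigned_matching (subxx F) Ff.
pose h n := (m n != n) && (arrs s aF 0 n == 0%N).
have size_m : (size (exposed d m) + 2 * count h (iota 0 d) = d)%N.
  apply: (heads_count mm) => v vd; last by case/andP.
  have [md mmv ev] := mm v vd => mv; rewrite /h mmv (eq_sym v) mv /=.
  by have /andP[_] := ev mv; do 2!case: (arrs _ _ _ _ == _).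
have sub : [set v : 'I_d | h v]%SET \subset ~: F.
  by apply/fintype.subsetP => v; rewrite !inE => /andP[_]; rewrite -input_F => ->.
have /eqP E : [set v : 'I_d | h v]%SET == ~: F.
  rewrite eqEcard sub -count_card -(leq_pmul2l (m := 2)) //=.
  rewrite -(leq_add2l (size (exposed d m))) size_m -[leqRHS]size_m' leq_add2r.
  exact: m_max.
move=> v vF; have : v \in ~: F by rewrite inE.
by rewrite -E inE => /andP[].
Qed.

(** A maximum matching that covers the complement of [F] leaves an optimal set
    when the end of each edge that its arc points to is removed. *)
Lemma maximum_matching_optimal (R : realType) m (J : {set 'I_d}) : (2 <= d)%N ->
  maximum_matching d (graph d s) m ->
  (forall v : 'I_d, v \notin F -> m v != v) ->
  (forall v : 'I_d, (v \in J) = ~~ arc s (m v) v) ->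
  optimal R A F J.
Proof.
move=> d_ge2 [mm m_max] cov JE.
have headP (v : 'I_d) : v \notin J -> exists2 w : 'I_d, m v = w & w \in J /\ A w v.
  rewrite JE negbK => mv; have [md mmv _] := mm v (ltn_ord v).
  exists (Ordinal md) => //; rewrite JE /= mmv; split; first exact: arc_asym.
  by have := mv; rewrite -[m v]/(val (Ordinal md)) arcE => /and4P[].
have size_m : (size (exposed d m) + 2 * #|~: J| = d)%N.
  have -> : #|~: J| = count (fun n => arc s (m n) n) (iota 0 d).
    by rewrite count_card; apply: eq_card => v; rewrite !inE JE negbK.
  apply: (heads_count mm) => v vd.
    have [md mmv ev] := mm v vd => /ev /and3P[_ _]; rewrite mmv.
    have := @arc_asym v (m v); have := @arc_asym (m v) v.
    by case: (arc s v (m v)) (arc s (m v) v) => [] [] // /(_ isT).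
  by apply: contraTneq => ->; rewrite arc_irrefl.
have JF : J \subset F.
  apply/fintype.subsetP => v vJ; apply: contraT => vF.
  have [md mmv ev] := mm v (ltn_ord v).
  have /and3P[_ _] := ev (cov v vF); move: vJ; rewrite JE => /negPf->.
  by rewrite orbF -[m v]/(val (Ordinal md)) arcE (negPf vF).
split.
  split=> //; apply/(obs_index_le2 R) => //.
  pose f (v : 'I_d) := odflt v [pick w : 'I_d | m v == w].
  have fE v w : m (val v) = val w -> f v = w.
    move=> mv; rewrite /f; case: pickP => [w' /eqP|/(_ w)]; last by rewrite mv eqxx.
    by rewrite mv => /val_inj ->.
  exists f; split=> [v /headP[w /fE-> []]//|v v' vJ v'J].
  have [w mv _] := headP v vJ; have [w' mv' _] := headP v' v'J.
  rewrite (fE _ _ mv) (fE _ _ mv') => ww'; apply: val_inj => /=.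
  have [_ <- _] := mm v (ltn_ord v); have [_ <- _] := mm v' (ltn_ord v').
  by rewrite mv mv' ww'.
move=> J' [J'F /(obs_index_le2 R A J' d_ge2)[f /(assigned_matching J'F)[m' [mm' size_m' _]]]].
have le_C : (#|~: J'| <= #|~: J|)%N.
  rewrite -(leq_pmul2l (m := 2)) // -(leq_add2l (size (exposed d m))) size_m.
  by rewrite -[leqRHS]size_m' leq_add2r m_max.
by rewrite -(leq_add2r #|~: J'|) cardsC -(cardsC J) leq_add2l.
Qed.

End Reduction.

(** [(d + 1) ^ 3 <= 8 d ^ 3] and [ln 2 <= ln d]. *)
Lemma cubic_le_cubic_log (R : realType) d : (2 <= d)%N ->
  (1000 * (50 * d.+1 ^ 3))%N%:R <=
    (1000 * (50 * 8))%N%:R / ln 2 * (d%:R ^+ 3 * ln d%:R) :> R.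
Proof.
move=> d_ge2; have ln2_gt0 : 0 < ln 2 :> R by rewrite ln_gt0 // ltr1n.
have ln2_le : ln 2 <= ln d%:R :> R.
  by rewrite ler_ln ?posrE ?ltr0n ?ler_nat // (leq_trans _ d_ge2).
have le_d : (d.+1 ^ 3 <= 8 * d ^ 3)%N.
  rewrite -[8%N]/(2 ^ 3)%N -expnMn leq_exp2r // mul2n -addnn -addn1 leq_add2l.
  exact: leq_trans d_ge2.
apply: (@le_trans _ _ ((1000 * (50 * 8))%:R * d%:R ^+ 3)).
  by rewrite -natrX -natrM ler_nat -!mulnA !leq_mul2l le_d !orbT.
rewrite -mulrA ler_wpM2l ?ler0n // mulrCA ler_peMr ?exprn_ge0 ?ler0n //.
by rewrite mulrC ler_pdivlMr // mul1r.
Qed.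

Theorem mainTheorem2 (R : realType) :
  exists (prog : cmd) (c : R),
    forall (d : nat) (A : sparsity d d) (F : {set 'I_d}),
      (2 <= d)%N ->
      (obs_index R A (sparsity_rows F) <= 2%:E)%E ->
      exists (t : nat) (s : state),
        [/\ exec prog (input_state A F) t s,
            optimal R A F (output_set d s)
          & t%:R <= c * (d%:R ^+ 3 * ln d%:R)].
Proof.
exists program, ((1000 * (50 * 8))%N%:R / ln 2) => d A F d_ge2.
move=> /(obs_index_le2 R A F d_ge2)[f Ff].
have [t [s [m1 [m2 [ex tle max1 max2 [cov out]]]]]] :=
  @programP d (input_state A F) erefl.
exists t, s; split=> //.
  apply: (maximum_matching_optimal R d_ge2 max2) => [v vF|v].
    by apply: cov => //; apply: cut_maximum_covers Ff max1 v vF.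
  by rewrite inE out.
apply: le_trans (cubic_le_cubic_log R d_ge2).
by rewrite ler_nat.
Qed.
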